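(* Let $T=T_N\to\infty$ as $N\to\infty$ with $\log T\sim N^{\zeta}$ for some $0<\zeta<1$. Let $r=e^{\Delta}$ for some (fixed) $\Delta>0$, let $0<\epsilon<1$ and let $\mu_0>0$ be given. Let $X^n_t\sim{\rm Poisson}(\mu^n_t)$ be independent, $1\le t\le T$, $1\le n\le N$. Under either of the following conditions, there is no algorithm (sequence of tests of $H_0:\boldsymbol{\mu}\in\Lambda_0$ versus $H_1:\boldsymbol{\mu}\in\Lambda_1(\Delta,V,h)$ based on the data) that achieves, as $N\to\infty$, $$\sup_{\boldsymbol{\mu}\in\Lambda_0}P_{\boldsymbol{\mu}}(\text{Type I error})+\sup_{\boldsymbol{\mu}\in\Lambda_1(\Delta,V,h)}P_{\boldsymbol{\mu}}(\text{Type II error})\to0 .$$ (a) $V=o\big(\tfrac{\log T}{\log N}\big)$ and $h=(1-\epsilon)I_r^{-1}\big(\tfrac{\log T}{\mu_0V}\big)$. (b) $V\sim N^{1-\beta}$ for some $\tfrac{1-\zeta}{2}<\beta<1-\zeta$ and $h=(1-\epsilon)\rho_r(\beta,\zeta)\big(\tfrac{\log N}{\mu_0}\big)$.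
   Context: $\boldsymbol{\mu}=(\mu^n_t:1\le t\le T,1\le n\le N)$ is the array of Poisson means and $P_{\boldsymbol{\mu}}$ is the corresponding probability. The set of change-points is $\boldsymbol{\tau}=\{t:\mu^n_t\ne\mu^n_{t+1}\text{ for some }n\}=\{\tau_1<\cdots<\tau_J\}$, $J=\#\boldsymbol{\tau}$, with $\tau_0=0$, $\tau_{J+1}=T$. $V=V_N$ is a positive integer (a number of sequences). Let $$m_{j\Delta}=\#\{n:|\log(\mu^n_{\tau_j+1}/\mu^n_{\tau_j})|\ge\Delta\},\qquad \Lambda=\{\boldsymbol{\mu}:\mu^n_t\ge\mu_0\text{ for all }n\text{ and }t\},\qquad \Lambda_0=\{\boldsymbol{\mu}\in\Lambda:J=0\},$$ $$\Lambda_1(\Delta,V,h)=\{\boldsymbol{\mu}\in\Lambda:\text{there exists }1\le j\le J\text{ such that }\min(\tau_{j+1}-\tau_j,\tau_j-\tau_{j-1})\ge h\text{ and }m_{j\Delta}\ge V\}.$$ A Type I error is concluding $H_1$ when $H_0$ is true; a Type II error is concluding $H_0$ when $H_1$ is true. For $r>1$, $$I_r=r\log\big(\tfrac{2r}{r+1}\big)+\log\big(\tfrac{2}{r+1}\big),\qquad g_r(\omega)=\Big(\tfrac{1+r^{\omega}}{2}\Big)^{1/\omega},$$ $$\rho_r(\beta,\zeta)=\max_{\frac{1-\zeta}{\beta}<\omega\le2}\Big(\frac{\beta-\omega^{-1}(1-\zeta)}{2g_r(\omega)-1-r}\Big)\quad\text{for }\tfrac{1-\zeta}{2}<\beta<1-\zeta.$$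 $a_N\sim b_N$ means $a_N/b_N\to1$. *)

(* Defs.v *)
From HB Require Import structures.
From mathcomp Require Import all_boot all_order all_algebra.
From mathcomp Require Import all_classical all_reals all_analysis.

Set Implicit Arguments.
Unset Strict Implicit.
Unset Printing Implicit Defensive.

Import Order.TTheory GRing.Theory Num.Theory.
Import numFieldNormedType.Exports.

Local Open Scope classical_set_scope.
Local Open Scope ring_scope.

Definition asymp_equiv (R : realType) (a b : nat -> R) : Prop :=
  (fun N => a N / b N) @ \oo --> (1 : R).

(* Arrays are N x T matrices whose column [i : 'I_T] carries time [i.+1].
   [mean mu n t] is the entry at the 1-based time [t]; the default value 0 is
   returned only outside 1 <= t <= T, which never occurs below. *)
Definition mean (R : realType) (N T : nat) (mu : 'M[R]_(N, T))
    (n : 'I_N) (t : nat) : R :=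
  if t is i.+1 then oapp (mu n) 0 (insub i) else 0.

Definition change_points (R : realType) (N T : nat) (mu : 'M[R]_(N, T)) :
    seq nat :=
  [seq t <- iota 1 T.-1 | [exists n : 'I_N, mean mu n t != mean mu n t.+1]].

Definition num_changes (R : realType) (N T : nat) (mu : 'M[R]_(N, T)) : nat :=
  size (change_points mu).

(* tau_0 = 0, tau_1 < ... < tau_J are the change-points, tau_(J+1) = T *)
Definition tau (R : realType) (N T : nat) (mu : 'M[R]_(N, T)) (j : nat) : nat :=
  nth T (0%N :: change_points mu) j.

Definition num_large_changes (R : realType) (N T : nat) (Delta : R)
    (mu : 'M[R]_(N, T)) (j : nat) : nat :=
  #|[set n : 'I_N |
      Delta <= `| ln (mean mu n (tau mu j).+1 / mean mu n (tau mu j)) |]|.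

Definition Lambda (R : realType) (N T : nat) (mu0 : R) : set 'M[R]_(N, T) :=
  [set mu | forall n t, mu0 <= mu n t].

Definition Lambda0 (R : realType) (N T : nat) (mu0 : R) : set 'M[R]_(N, T) :=
  [set mu | Lambda mu0 mu /\ num_changes mu = 0%N].

Definition Lambda1 (R : realType) (N T : nat) (mu0 Delta : R) (V : nat)
    (h : R) : set 'M[R]_(N, T) :=
  [set mu | Lambda mu0 mu /\
    exists j : nat, [/\ (1 <= j <= num_changes mu)%N,
      h <= (minn (tau mu j.+1 - tau mu j) (tau mu j - tau mu j.-1))%:R &
      (V <= num_large_changes Delta mu j)%N]].

Definition mutually_independent (R : realType) (d d' : measure_display)
    (Omega : measurableType d) (E : measurableType d') (P : probability Omega R)
    (I : finType) (X : I -> Omega -> E) : Prop :=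
  forall (J : {set I}) (A : I -> set E), (forall i, measurable (A i)) ->
    P (\bigcap_(i in [set` J]) (X i @^-1` A i)) =
    (\prod_(i in J) P (X i @^-1` A i))%E.

(* [P] is the family of laws indexed by the arrays of means; the observed data
   [X] do not depend on the unknown array. *)
Definition poisson_model (R : realType) (d : measure_display)
    (Omega : measurableType d) (N T : nat)
    (P : 'M[R]_(N, T) -> probability Omega R)
    (X : Omega -> 'M[nat]_(N, T)) : Prop :=
  (forall n t, measurable_fun [set: Omega] (fun w => X w n t)) /\
  forall mu : 'M[R]_(N, T), (forall n t, 0 < mu n t) ->
    (forall n t (k : nat),
       P mu [set w | X w n t = k] = (poisson_pmf (mu n t) k)%:E) /\
    mutually_independent (P mu)
      (fun (nt : 'I_N * 'I_T) (w : Omega) => X w nt.1 nt.2).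

(* A test is a function of the data; [true] means concluding H_1.  Suprema are
   of subsets of [0, 1], the supremum over an empty class being 0. *)
Definition sup_type1_error (R : realType) (d : measure_display)
    (Omega : measurableType d) (N T : nat)
    (P : 'M[R]_(N, T) -> probability Omega R) (X : Omega -> 'M[nat]_(N, T))
    (H0 : set 'M[R]_(N, T)) (test : 'M[nat]_(N, T) -> bool) : R :=
  sup [set fine (P mu [set w | test (X w)]) | mu in H0].

Definition sup_type2_error (R : realType) (d : measure_display)
    (Omega : measurableType d) (N T : nat)
    (P : 'M[R]_(N, T) -> probability Omega R) (X : Omega -> 'M[nat]_(N, T))
    (H1 : set 'M[R]_(N, T)) (test : 'M[nat]_(N, T) -> bool) : R :=
  sup [set fine (P mu [set w | ~~ test (X w)]) | mu in H1].

Definition I_rate (R : realType) (r : R) : R :=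
  r * ln (2 * r / (r + 1)) + ln (2 / (r + 1)).

Definition g_fun (R : realType) (r omega : R) : R :=
  ((1 + r `^ omega) / 2) `^ omega^-1.

(* The maximum over the half-open interval is attained, hence equal to the
   supremum: for r > 1 and 1 < (1 - zeta) / beta < 2 the denominator is positive
   on the closed interval and the numerator vanishes at the excluded endpoint
   while being positive inside. *)
Definition rho_fun (R : realType) (r beta zeta : R) : R :=
  sup [set (beta - omega^-1 * (1 - zeta)) / (2 * g_fun r omega - 1 - r)
      | omega in `](1 - zeta) / beta, 2]%classic].

(* Main.v *)
Require Import Defs.
From HB Require Import structures.
From mathcomp Require Import all_boot all_order all_algebra.
From mathcomp Require Import all_classical all_reals all_analysis.
From mathcomp Require Import ring lra zify.

Set Implicit Arguments.
Unset Strict Implicit.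
Unset Printing Implicit Defensive.

Import Order.TTheory GRing.Theory Num.Theory.
Import numFieldNormedType.Exports.
Local Open Scope classical_set_scope.
Local Open Scope ring_scope.

(** Lower bound by a needle in a haystack. Round [h] up to an integer [H] and
cut the time axis into [M] disjoint windows of length [2 * H]. Under the null
law all means equal some [lam >= mu0]. Under the alternative, a window [k] is
drawn uniformly, every sequence [n] enters a random set [S] independently with
probability [p n], and the sequences of [S] have mean [mu0] on the first half of
the window and [r * mu0] on the second half; everything else stays at [lam]. The
middle of the window is then a change-point at distance at least [H] from every
other one, so the array is in [Lambda1] as soon as [V <= #|S|]
([pulse_mean_Lambda1]). Up to the prior probability of [#|S| < V], kept below
1/16 by [inclusion_tail], the two suprema together dominate the error of testing
the null law against the mixture, whose likelihood ratio is the average over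
the windows of [L_k = \prod_n (1 - p n + p n * l_(k, n))], where [l_(k, n)] is
the ratio of the row [n] alone ([window_ratio], [row_ratio]).

Under the null law the [L_k] have mean 1 and [E (L_k * L_l) = 1] for [k != l].
If they are truncated at the level [M / 8], their average has second moment at
most [1 + 1 / 8], and the truncation loses at most
[(M / 8) ^ (- s) * E (L_k ^ (1 + s))]. When this loss is small the average is
close to 1 in mean square, and no test separates the two hypotheses
([mixture_testing_lower_bound], [risk_lower_bound]). Since [M] is [T] up to a
factor of order [ln T], it remains to get
[E (L_k ^ (1 + s)) <= T ^ ((1 - sigma) * s)] for some [s] in ]0, 1] and some
[sigma > 0] ([risk_ge_of_log_bounds]).

All null expectations come from one fact: weighting a Poisson law by a power
[theta ^ x] gives, up to a constant, another Poisson law, so they are read off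
from the total mass 1 of the tilted law ([null_mean_row_mixture]). The power
[1 + s] of [1 - p + p * l] lies below a combination of [1], [l] and
[l ^ (1 + s)] whose coefficients make
[E (L_k ^ (1 + s)) <= \prod_n (1 + p n ^ (1 + s) * K)], with
[K = E (l ^ (1 + s)) = expR (H * mu0 * kappa)] for an explicit [kappa]
([inclusion_power_bound], [null_mean_window_ratio_powR]).

For sparse changes, [S] is the fixed set of the first [V] sequences and [lam] is
the midpoint of [mu0] and [r * mu0]. Then [kappa] is [s * I_rate r] to first
order in [s] ([midpoint_exponent]), and [V * mu0 * h * I_rate r] is
[(1 - eps) * ln T]. For dense changes, [p] is [8 * V / N] and [1 + s] is a point
[om] where the quotient defining [rho_fun] exceeds [(1 - eps) * rho_fun]; the
choice [lam = g_fun r om * mu0] minimizes [kappa], whose value is then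
[om * (2 * g_fun r om - 1 - r)]. The exponents add up to
[N * p ^ om * K <= C * N ^ (zeta - gamma)] with [gamma > 0], which is negligible
against [ln T] ([rho_exponent]). *)

(** * Sums over countable types and laws of discrete data *)

Lemma esumZl (R : realType) (S : choiceType) (c : R) (f : S -> \bar R) :
  0 <= c -> (forall x, 0 <= f x)%E ->
  (\esum_(x in [set: S]) (c%:E * f x) = c%:E * \esum_(x in [set: S]) f x)%E.
Proof.
move=> c0 f0.
have le_c (k : R) (g : S -> \bar R) : 0 <= k -> (forall x, 0 <= g x)%E ->
    (\esum_(x in [set: S]) (k%:E * g x) <= k%:E * \esum_(x in [set: S]) g x)%E.
  move=> k0 g0; apply: ge_ereal_sup => /= _ [A [finA _] <-].
  rewrite -ge0_mule_fsumr//; apply: lee_wpmul2l; first by rewrite lee_fin.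
  by apply: esum_ge; exists A.
have [<-|c1] := eqVneq 0 c.
  by rewrite mul0e esum1// => x _; rewrite mul0e.
have {c1}c0 : 0 < c by rewrite lt_neqAle c1.
apply/eqP; rewrite eq_le le_c//= ?(ltW c0)//.
rewrite -lee_pdivlMl//.
apply: le_trans (le_c _ _ _ _); last 2 first.
- by rewrite invr_ge0 ltW.
- by move=> x; rewrite mule_ge0// lee_fin ltW.
apply: le_esum => x _.
by rewrite muleA -EFinM mulVf ?gt_eqF// mul1e.
Qed.

(** The event is a countable disjoint union of fibres, so that the point masses
determine the law of [X] without any measurable structure on [S]. *)
Lemma probability_countable_preimage (R : realType) (d : measure_display)
    (Omega : measurableType d) (P : probability Omega R) (S : countType)
    (X : Omega -> S) (mX : forall x, measurable [set w | X w = x]) (A : set S) :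
  measurable [set w | A (X w)] /\
  P [set w | A (X w)] = \esum_(x in A) P [set w | X w = x].
Proof.
pose F k := [set w | pickle (X w) = k].
have FE x : F (pickle x) = [set w | X w = x].
  by apply/seteqP; split=> w /=; [exact: (pcan_inj pickleK)|rewrite /F/= => ->].
have mF k : (pickle @` A) k -> measurable (F k) by move=> [x _ <-]; rewrite FE.
have tF : trivIset (pickle @` A) F.
  by move=> i j _ _ [w []]; rewrite /F/= => <- <-.
have AE : [set w | A (X w)] = \bigcup_(k in pickle @` A) F k.
  apply/seteqP; split => [w Aw|w [k [x Ax <-]]] /=.
    by exists (pickle (X w)) => //; exists (X w).
  by rewrite /F/= => /(pcan_inj pickleK) ->.
split; first by rewrite AE; exact: bigcup_measurable.
rewrite AE measure_bigcup// nneseries_esum// set_mem_set esum_image; last first.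
  by move=> x y _ _; exact: (pcan_inj pickleK).
by apply: eq_esum => x _; rewrite FE.
Qed.

(** * Poisson arrays and their exponential moments *)

Definition poisson_mass (R : realType) (N T : nat) (mu : 'M[R]_(N, T))
    (x : 'M[nat]_(N, T)) : R :=
  \prod_n \prod_t poisson_pmf (mu n t) (x n t).

Lemma poisson_mass_ge0 (R : realType) (N T : nat) (mu : 'M[R]_(N, T)) x :
  0 <= poisson_mass mu x.
Proof.
by apply: prodr_ge0 => n _; apply: prodr_ge0 => t _; exact: poisson_pmf_ge0.
Qed.

Section data_law.
Context (R : realType) (d : measure_display) (Omega : measurableType d)
  (N T : nat) (P : 'M[R]_(N, T) -> probability Omega R)
  (X : Omega -> 'M[nat]_(N, T)) (model : poisson_model P X).

Let entry_event (x : 'M[nat]_(N, T)) (i : 'I_N * 'I_T) :=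
  (fun w => X w i.1 i.2) @^-1` [set x i.1 i.2].

Let eventE x :
  [set w | X w = x] = \bigcap_(i in [set` [set: 'I_N * 'I_T]%SET]) entry_event x i.
Proof.
apply/seteqP; split=> [w /= <- i _//|w /= Fw]; apply/matrixP => n t.
by have := Fw (n, t); apply; rewrite /= inE.
Qed.

Let measurable_event x : measurable [set w | X w = x].
Proof.
rewrite eventE; apply: fin_bigcap_measurable => [|i _]; first exact: finite_finset.
by rewrite -[entry_event x i]setTI; apply: (model.1 i.1 i.2).
Qed.

Lemma poisson_model_measurable (A : set 'M[nat]_(N, T)) :
  measurable [set w | A (X w)].
Proof.
by have [] := probability_countable_preimage (P 0) measurable_event A.
Qed.

Lemma poisson_model_law (mu : 'M[R]_(N, T)) (A : set 'M[nat]_(N, T)) :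
  (forall n t, 0 < mu n t) ->
  P mu [set w | A (X w)] = \esum_(x in A) (poisson_mass mu x)%:E.
Proof.
move=> mu0; have [pmf indep] := model.2 _ mu0.
have [_ ->] := probability_countable_preimage (P mu) measurable_event A.
apply: eq_esum => x _; rewrite eventE indep; last by [].
rewrite (eq_bigr (fun i => (poisson_pmf (mu i.1 i.2) (x i.1 i.2))%:E)) => [|i _].
  rewrite prodEFin; congr EFin.
  by rewrite /poisson_mass pair_bigA; apply: eq_bigl => i; rewrite inE.
exact: pmf.
Qed.

End data_law.

Section poisson_generating.
Context (R : realType) (N T : nat) (lam : R) (lam_gt0 : 0 < lam).
Context (mass1 : forall mu : 'M[R]_(N, T), (forall n t, 0 < mu n t) ->
  \esum_(x in [set: 'M[nat]_(N, T)]) (poisson_mass mu x)%:E = 1%E).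

(** The value is an extended real, so that means of nonnegative functions need
no integrability hypothesis. *)
Definition null_mean (f : 'M[nat]_(N, T) -> R) : \bar R :=
  \esum_(x in [set: 'M[nat]_(N, T)]) (poisson_mass (const_mx lam) x * f x)%:E.

(** [theta ^ x] turns the rate [lam] of a Poisson law into [lam * theta], at the
price of the constant [expR (lam * (theta - 1))]. *)
Lemma poisson_mass_tilt (theta : 'I_N -> 'I_T -> R) (x : 'M[nat]_(N, T)) :
  (forall n t, 0 < theta n t) ->
  poisson_mass (const_mx lam) x * \prod_n \prod_t theta n t ^+ x n t =
  (\prod_n \prod_t expR (lam * (theta n t - 1))) *
  poisson_mass (\matrix_(n, t) (lam * theta n t)) x.
Proof.
move=> theta0; rewrite /poisson_mass -!big_split/=; apply: eq_bigr => n _.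
rewrite -!big_split/=; apply: eq_bigr => t _.
rewrite !mxE /poisson_pmf lam_gt0 mulr_gt0// exprMn.
have -> : expR (- lam) = expR (lam * (theta n t - 1)) * expR (- (lam * theta n t)).
  by rewrite -expRD; congr expR; ring.
by ring.
Qed.

Lemma null_mean_tilt (theta : 'I_N -> 'I_T -> R) :
  (forall n t, 0 < theta n t) ->
  null_mean (fun x => \prod_n \prod_t theta n t ^+ x n t) =
  (\prod_n \prod_t expR (lam * (theta n t - 1)))%:E.
Proof.
move=> theta0; rewrite /null_mean.
under eq_esum => x _ do rewrite poisson_mass_tilt// EFinM.
rewrite esumZl; last 2 first.
- by apply: prodr_ge0 => n _; apply: prodr_ge0 => t _; exact: expR_ge0.
- by move=> x; rewrite lee_fin poisson_mass_ge0.
by rewrite mass1 ?mule1// => n t; rewrite mxE mulr_gt0.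
Qed.

(** Every null expectation below is of this form: a product over the rows of
finite sums of exponential functions of the row. The product expands into a sum
of tilts, each of which is a product over the rows, and the sum folds back. *)
Lemma null_mean_row_mixture (J : finType) (c : 'I_N -> J -> R)
    (theta : J -> 'I_T -> R) :
  (forall n j, 0 <= c n j) -> (forall j t, 0 < theta j t) ->
  null_mean (fun x => \prod_n \sum_j c n j * \prod_t theta j t ^+ x n t) =
  (\prod_n \sum_j c n j * \prod_t expR (lam * (theta j t - 1)))%:E.
Proof.
move=> c0 theta0; rewrite !bigA_distr_bigA /null_mean.
pose g (f : {ffun 'I_N -> J}) x : R := (poisson_mass (const_mx lam) x *
   \prod_n \prod_t theta (f n) t ^+ x n t).
have g0 f x : (0 <= (g f x)%:E)%E.
  rewrite lee_fin mulr_ge0 ?poisson_mass_ge0//.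
  by apply: prodr_ge0 => n _; apply: prodr_ge0 => t _; rewrite exprn_ge0// ltW.
have c00 (f : {ffun 'I_N -> J}) : 0 <= \prod_n c n (f n).
  by apply: prodr_ge0 => n _.
transitivity (\esum_(x in [set: 'M[nat]_(N, T)])
    (\sum_(f : {ffun 'I_N -> J}) (\prod_n c n (f n))%:E * (g f x)%:E)%E).
  apply: eq_esum => x _; rewrite bigA_distr_bigA mulr_sumr -sumEFin.
  apply: eq_bigr => f _; rewrite -EFinM big_split/= /g; congr EFin.
  by rewrite mulrCA.
rewrite esum_sum => [|x f _ _]; last by rewrite mule_ge0// lee_fin.
rewrite -sumEFin; apply: eq_bigr => f _.
rewrite esumZl// big_split/= EFinM; congr (_ * _)%E.
by rewrite -(@null_mean_tilt (fun n => theta (f n))).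
Qed.

End poisson_generating.

(** * Testing against a mixture of nearly orthogonal alternatives *)

(** Markov's inequality for the part of [y] above [c], in a pointwise form. *)
Lemma truncation_power_bound (R : realType) (c s y : R) :
  0 < c -> 0 <= s -> 0 <= y -> y <= Num.min y c + c `^ (- s) * y `^ (1 + s).
Proof.
move=> c0 s0 y0; rewrite minEle; case: ifPn => [yc|].
  by rewrite lerDl mulr_ge0// powR_ge0.
rewrite -ltNge => cy; apply: ler_wpDl; first exact: ltW.
rewrite powRD ?(gt_eqF (lt_trans c0 cy)) ?implybT// powRr1// mulrCA.
rewrite ler_peMr// powRN mulrC ler_pdivlMr ?powR_gt0// mul1r.
by rewrite ge0_ler_powR// ?nnegrE// ltW.
Qed.

(** Let [Y] be the average of the [L k] truncated at [c]. The left-hand side is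
bounded through [2 * Y <= phi + (1 - phi) * Y + 1 / 4 + Y ^ 2], true for both
values of [phi]. On the right, [Y ^ 2] is expanded into its off-diagonal part,
where the truncation is dropped, and its diagonal part, where one of the two
factors is bounded by [c]. All terms are nonnegative, so that the inequality can
be summed against the null law without any integrability condition. *)
Lemma truncated_mixture_pointwise (R : realType) (M : nat) (c s : R)
    (L : 'I_M -> R) (phi : bool) :
  (0 < M)%N -> 0 < c -> 0 <= s -> (forall k, 0 <= L k) ->
  2 * (M%:R^-1 * \sum_k L k) <=
  phi%:R + (~~ phi)%:R * (M%:R^-1 * \sum_k L k) + 4^-1 +
  M%:R ^- 2 * (\sum_k \sum_(l | l != k) L k * L l) +
  c * M%:R ^- 2 * (\sum_k L k) +
  2 * c `^ (- s) * M%:R^-1 * (\sum_k L k `^ (1 + s)).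
Proof.
move=> M0 c0 s0 L0; pose Y k := Num.min (L k) c.
have Y0 k : 0 <= Y k by rewrite le_min L0 ltW.
have YL k : Y k <= L k by rewrite ge_min lexx.
have Yc k : Y k <= c by rewrite ge_min lexx orbT.
have m0 : 0 < M%:R^-1 :> R by rewrite invr_gt0 ltr0n.
set m := M%:R^-1; set SL := \sum_k L k; set SY := \sum_k Y k.
have YLs : SY <= SL by exact: ler_sum.
have SY0 : 0 <= SY by exact: sumr_ge0.
have sq : SY ^+ 2 <= (\sum_k \sum_(l | l != k) L k * L l) + c * SL.
  rewrite expr2 {1}/SY mulr_suml /SL mulr_sumr -big_split/=.
  apply: ler_sum => k _; rewrite /SY mulr_sumr (bigD1 k)//= addrC lerD//.
    by apply: ler_sum => l _; exact: ler_pM.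
  by rewrite mulrC; exact: ler_pM.
have lin : SL <= SY + c `^ (- s) * \sum_k L k `^ (1 + s).
  rewrite mulr_sumr -big_split/=; apply: ler_sum => k _.
  exact: truncation_power_bound.
(* The two values of [phi] reduce to [(y - 1) ^+ 2 + 1 / 4 >= 0] and to
   [(y - 1 / 2) ^+ 2 >= 0]. *)
have amgm : 2 * (m * SY) <= phi%:R + (~~ phi)%:R * (m * SY) + 4^-1 + (m * SY) ^+ 2.
  have : 0 <= m * SY by rewrite mulr_ge0// ltW.
  move: (m * SY) => y y0; case: phi => /=.
    by have := sqr_ge0 (y - 1); nra.
  by have := sqr_ge0 (y - 2^-1); nra.
have mono : (~~ phi)%:R * (m * SY) <= (~~ phi)%:R * (m * SL).
  by rewrite ler_wpM2l// ler_wpM2l// ltW.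
have -> : M%:R ^- 2 = m ^+ 2 :> R by rewrite exprVn.
move: sq lin amgm mono; move: (\sum_k \sum_(l | _) _) => Q.
move: (\sum_k L k `^ _) (c `^ _) => B C sq lin amgm mono.
have h1 : m ^+ 2 * SY ^+ 2 <= m ^+ 2 * (Q + c * SL).
  by rewrite ler_wpM2l// sqr_ge0.
have h2 : 2 * m * SL <= 2 * m * (SY + C * B).
  by rewrite ler_wpM2l// mulr_ge0// ltW.
by rewrite exprMn in amgm; lra.
Qed.

Section bayes_risk.
Context (R : realType) (S : choiceType) (p0 : S -> R) (M : nat)
  (L : 'I_M -> S -> R) (phi : S -> bool) (c s B : R).
Context (p0_ge0 : forall x, 0 <= p0 x) (M_gt0 : (0 < M)%N)
  (L_ge0 : forall k x, 0 <= L k x) (c_gt0 : 0 < c) (s_ge0 : 0 <= s).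
Let E (f : S -> R) : \bar R := \esum_(x in [set: S]) (p0 x * f x)%:E.
Context (E1 : E (cst 1) = 1%E) (EL : forall k, E (L k) = 1%E)
  (ELL : forall k l, k != l -> E (fun x => L k x * L l x) = 1%E)
  (ELp : forall k, (E (fun x => L k x `^ (1 + s))%R <= B%:E)%E).

(** If the [L k] are likelihood ratios with pairwise product of mean 1, their
average is close to 1 in mean square after truncation at [c], hence a test can
hardly tell the mixture from [p0]. The moment of order [1 + s] pays for the
truncation. *)
Lemma mixture_testing_lower_bound :
  ((3 / 4 - c / M%:R - 2 * c `^ (- s) * B)%R%:E <=
   E (fun x => (phi x)%:R)%R +
   E (fun x => (~~ phi x)%:R * (M%:R^-1 * \sum_k L k x))%R)%E.
Proof.
have EZ (k : R) f : 0 <= k -> (forall x, 0 <= f x) ->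
    E (fun x => k * f x) = (k%:E * E f)%E.
  move=> k0 f0; rewrite /E -esumZl//; last first.
    by move=> x; rewrite lee_fin mulr_ge0.
  by apply: eq_esum => x _; rewrite -EFinM mulrCA.
have ED f g : (forall x, 0 <= f x) -> (forall x, 0 <= g x) ->
    E (fun x => f x + g x) = (E f + E g)%E.
  move=> f0 g0; rewrite /E -esumD//.
  - by apply: eq_esum => x _; rewrite -EFinD mulrDr.
  - by move=> x _; rewrite lee_fin mulr_ge0.
  - by move=> x _; rewrite lee_fin mulr_ge0.
have Esum (I : finType) (Q : pred I) (f : I -> S -> R) :
    (forall i x, 0 <= f i x) ->
    E (fun x => \sum_(i | Q i) f i x) = (\sum_(i | Q i) E (f i))%E.
  move=> f0; rewrite /E -esum_sum; last first.
    by move=> x i _ _; rewrite lee_fin mulr_ge0.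
  by apply: eq_esum => x _; rewrite sumEFin mulr_sumr.
have Ele f g : (forall x, f x <= g x) -> (E f <= E g)%E.
  by move=> fg; apply: le_esum => x _; rewrite lee_fin ler_wpM2l.
have m0 : 0 < M%:R^-1 :> R by rewrite invr_gt0 ltr0n.
have SL0 x : 0 <= \sum_k L k x by exact: sumr_ge0.
have ESL : E (fun x => \sum_k L k x) = M%:R%:E.
  rewrite Esum//; under eq_bigr do rewrite EL.
  by rewrite sumEFin sumr_const card_ord.
have ESLL : (E (fun x => \sum_k \sum_(l | l != k) L k x * L l x)%R <= (M%:R ^+ 2)%R%:E)%E.
  rewrite Esum => [|i x]; last by apply: sumr_ge0 => l _; exact: mulr_ge0.
  rewrite (eq_bigr (fun k => (\sum_(l < M | l != k) 1%E)%E)); last first.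
    move=> k _; rewrite Esum => [|i x]; last exact: mulr_ge0.
    by apply: eq_bigr => l kl; rewrite ELL// eq_sym.
  apply: (@le_trans _ _ (\sum_(k < M) \sum_(l < M) 1)%E).
    apply: lee_sum => k _; rewrite [leLHS]big_mkcond; apply: lee_sum => l _.
    by case: ifP.
  rewrite (eq_bigr (fun=> M%:R%:E)) => [|k _]; last first.
    by rewrite sumEFin sumr_const card_ord.
  by rewrite sumEFin sumr_const card_ord -[M%:R *+ M]mulr_natr lee_fin expr2.
have ESp : (E (fun x => \sum_k L k x `^ (1 + s))%R <= (M%:R * B)%R%:E)%E.
  rewrite Esum => [|i x]; last exact: powR_ge0.
  apply: (@le_trans _ _ (\sum_(k < M) B%:E)%E); first exact: lee_sum.
  by rewrite sumEFin sumr_const card_ord -[B *+ M]mulr_natl.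
set X1 := E _; set X2 := E _.
have key : ((2 : R)%:E <= X1 + X2 + (4^-1)%R%:E + 1 + (c / M%:R)%R%:E +
    (2 * c `^ (- s) * B)%R%:E)%E.
  have -> : (2 : R)%:E = E (fun x => 2 * (M%:R^-1 * \sum_k L k x)).
    rewrite EZ// => [|x]; last by rewrite mulr_ge0// ltW.
    by rewrite EZ// ?ESL -?EFinM ?mulVf ?mulr1// ?pnatr_eq0 -?lt0n// ltW.
  apply: (@le_trans _ _ (E (fun x => (phi x)%:R +
      (~~ phi x)%:R * (M%:R^-1 * \sum_k L k x) + 4^-1 * cst 1 x +
      M%:R ^- 2 * (\sum_k \sum_(l | l != k) L k x * L l x) +
      c * M%:R ^- 2 * (\sum_k L k x) +
      2 * c `^ (- s) * M%:R^-1 * (\sum_k L k x `^ (1 + s)))%R)).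
    apply: Ele => x; rewrite [4^-1 * _]mulr1.
    exact: (@truncated_mixture_pointwise _ M c s (fun k => L k x)).
  have p1 x : 0 <= (~~ phi x)%:R * (M%:R^-1 * \sum_k L k x).
    by rewrite !mulr_ge0// ltW.
  have p2 x : 0 <= \sum_k \sum_(l | l != k) L k x * L l x.
    by apply: sumr_ge0 => k _; apply: sumr_ge0 => l _; exact: mulr_ge0.
  have p3 x : 0 <= \sum_k L k x `^ (1 + s).
    by apply: sumr_ge0 => k _; exact: powR_ge0.
  have k1 : 0 <= M%:R ^- 2 :> R by rewrite invr_ge0 exprn_ge0.
  have k2 : 0 <= c * M%:R ^- 2 by rewrite mulr_ge0// ltW.
  have k3 : 0 <= 2 * c `^ (- s) * M%:R^-1.
    by rewrite !mulr_ge0// ?powR_ge0// ltW.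
  have k4 : 0 <= 4^-1 :> R by [].
  have n1 x : 0 <= 4^-1 * cst 1 x :> R by rewrite mulr_ge0.
  rewrite !ED => *; rewrite ?(addr_ge0, mulr_ge0, powR_ge0, ltW c_gt0)//.
  rewrite (EZ 4^-1)// E1 mule1 (EZ (M%:R ^- 2))// (EZ (c * _))// (EZ (2 * _ * _))//.
  rewrite ESL; apply: leeD; first apply: leeD; first apply: leeD => //.
  - apply: (le_trans (lee_wpmul2l _ ESLL)); first by rewrite lee_fin.
    by rewrite -EFinM mulVf// expf_neq0// pnatr_eq0 -lt0n.
  - rewrite -EFinM lee_fin expr2 invfM.
    by rewrite -!mulrA mulVf ?mulr1// pnatr_eq0 -lt0n.
  - apply: (le_trans (lee_wpmul2l _ ESp)); first by rewrite lee_fin.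
    rewrite -EFinM lee_fin -!mulrA (mulrA M%:R^-1) mulVf ?mul1r//.
    by rewrite pnatr_eq0 -lt0n.
have X10 : (0 <= X1)%E by rewrite /X1; apply: esum_ge0 => x _; rewrite lee_fin; apply: mulr_ge0.
have X20 : (0 <= X2)%E.
  by rewrite /X2; apply: esum_ge0 => x _; rewrite lee_fin !mulr_ge0 ?ler0n// ltW.
have X0 := adde_ge0 X10 X20.
move: key X0; move: (X1 + X2)%E => [z||]//= + _; last by move=> _; exact: leey.
by rewrite -!EFinD !lee_fin; lra.
Qed.

End bayes_risk.

(** * Likelihood ratios of random sets of sequences in a window *)

(** Factor applied at time [t] (counted from 0) to the null mean by a change in
the middle of the [k]-th window of length [2 * H]. *)
Definition pulse (R : realType) (a b : R) (H k t : nat) : R :=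
  if (2 * H * k <= t < 2 * H * k + H)%N then a
  else if (2 * H * k + H <= t < 2 * H * k + 2 * H)%N then b else 1.

Lemma window_fits (H M T k : nat) :
  (2 * H * M <= T)%N -> (k < M)%N -> (2 * H * k + 2 * H <= T)%N.
Proof. by move=> MT kM; rewrite addnC -mulnS (leq_trans _ MT)// leq_mul2l kM orbT. Qed.

Lemma pulse_gt0 (R : realType) (a b : R) (H k t : nat) :
  0 < a -> 0 < b -> 0 < pulse a b H k t.
Proof. by rewrite /pulse => a0 b0; do 2 case: ifP => // _. Qed.

Lemma pulse_disjoint (R : realType) (a b : R) (H k l t : nat) : k != l ->
  pulse a b H k t = 1 \/ pulse a b H l t = 1.
Proof.
move=> kl; have [out|inn] := boolP (2 * H * k <= t < 2 * H * k + 2 * H)%N.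
  right; rewrite /pulse; case: ifP => [h1|_].
    by exfalso; move/eqP: kl; apply; nia.
  case: ifP => // h1; by exfalso; move/eqP: kl; apply; nia.
left; rewrite /pulse; case: ifP => [h1|_]; first by exfalso; move: inn; lia.
by case: ifP => // h1; exfalso; move: inn; lia.
Qed.

Lemma sum_pulse (R : realType) (a b : R) (H k T : nat) (f : R -> R) :
  f 1 = 0 -> (2 * H * k + 2 * H <= T)%N ->
  \sum_(t < T) f (pulse a b H k t) = H%:R * (f a + f b).
Proof.
move=> f1 kT; rewrite -(big_mkord xpredT (fun t => f (pulse a b H k t))).
rewrite (@big_cat_nat _ _ _ (2 * H * k))//=; last by lia.
rewrite (@big_cat_nat _ _ _ (2 * H * k + H) (2 * H * k))//=; [|by lia..].
rewrite (@big_cat_nat _ _ _ (2 * H * k + 2 * H) (2 * H * k + H))//=; [|by lia..].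
have const (m n : nat) (v : R) : (forall t, (m <= t < n)%N -> f (pulse a b H k t) = v) ->
    \sum_(m <= t < n) f (pulse a b H k t) = v *+ (n - m).
  by move=> fv; rewrite (eq_big_nat _ _ fv) sumr_const_nat.
rewrite (const _ _ 0); last first.
  move=> t tk; rewrite /pulse; case: ifP => [h|_]; first by exfalso; lia.
  by case: ifP => // h; exfalso; lia.
rewrite (const _ _ (f a)); last by move=> t tk; rewrite /pulse tk.
rewrite (const _ _ (f b)); last first.
  by move=> t tk; rewrite /pulse tk; case: ifP => [h|//]; exfalso; lia.
rewrite (const _ _ 0); last first.
  move=> t tk; rewrite /pulse; case: ifP => [h|_]; first by exfalso; lia.
  by case: ifP => // h; exfalso; lia.
rewrite !mul0rn add0r addr0 mulrDr !mulr_natl.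
congr (_ *+ _ + _ *+ _); lia.
Qed.

(** Concavity of [z ^ s]. With [w = ln z], it is the sum of [1 + x <= expR x] at
[w - w * s] with weight [s] and at [- (w * s)] with weight [1 - s]. *)
Lemma powR_le_tangent (R : realType) (s z : R) :
  0 <= s <= 1 -> 0 < z -> z `^ s <= 1 + s * (z - 1).
Proof.
move=> /andP[s0 s1] z0; rewrite -(lnK z0); set w := ln z; rewrite -expRM.
have e1 := expR_ge1Dx (w - w * s); have e2 := expR_ge1Dx (- (w * s)).
have key : 1 <= s * expR (w - w * s) + (1 - s) * expR (- (w * s)) by nra.
have := ler_wpM2l (expR_ge0 (w * s)) key.
rewrite mulr1 mulrDr !(mulrCA (expR (w * s))) -!expRD.
rewrite (addrC (w * s)) subrK addrN expR0; lra.
Qed.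

Lemma powR_subadditive (R : realType) (s u v : R) :
  0 <= s <= 1 -> 0 <= u -> 0 <= v -> 0 < u + v ->
  (u + v) `^ s <= u `^ s + v `^ s.
Proof.
move=> /andP[s0 s1] u0 v0 m0; set m := u + v.
have le_m (y : R) : 0 <= y -> y <= m -> m `^ s * (y / m) <= y `^ s.
  move=> y0 ym; have ym0 : 0 <= y / m by rewrite divr_ge0// ltW.
  rewrite -[in leRHS](@divfK _ m _ y) ?gt_eqF// mulrC powRM//; last exact: ltW.
  rewrite ler_wpM2r ?powR_ge0//; have [->|yN0] := eqVneq (y / m) 0.
    exact: powR_ge0.
  by rewrite ger1_powR// lt_neqAle eq_sym yN0 ym0/= ler_pdivrMr// mul1r.
have : m `^ s * (u / m) + m `^ s * (v / m) <= u `^ s + v `^ s.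
  by apply: lerD; apply: le_m; rewrite // ?lerDl ?lerDr.
by rewrite -mulrDr -mulrDl divff ?mulr1// gt_eqF.
Qed.

(** Write [z ^ (1 + s) = (1 - p) * z ^ s + p * y * z ^ s] for
[z = 1 - p + p * y], and bound [z ^ s] by its tangent at 1 in the first term, by
subadditivity in the second. The point is that for [y] of mean 1 the right-hand
side has mean [1 + p ^ (1 + s) * E (y ^ (1 + s))]: the linear terms cancel
exactly, and a small [p] gains the full factor [p ^ (1 + s)]. *)
Lemma inclusion_power_bound (R : realType) (p s y : R) :
  0 <= p <= 1 -> 0 < s <= 1 -> 0 < y ->
  (1 - p + p * y) `^ (1 + s) <=
  (1 - p) * (1 - s * p) + ((1 - p) * s * p + p) * y + p `^ (1 + s) * y `^ (1 + s).
Proof.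
move=> /andP[p0 p1] /andP[s0 s1] y0; set z := 1 - p + p * y.
have z0 : 0 < z.
  rewrite /z; have [->|pN1] := eqVneq p 1; first by rewrite subrr add0r mul1r.
  by rewrite ltr_wpDr ?(mulr_ge0 p0 (ltW y0))// subr_gt0 lt_neqAle pN1.
have s01 : 0 <= s <= 1 by rewrite ltW.
have powR1s (x : R) : 0 <= x -> x `^ (1 + s) = x * x `^ s.
  move=> x0; rewrite -(@mulr_powRB1 _ x (1 + s))//; last by lra.
  by rewrite (addrC 1) addrK.
have t1 : z `^ s <= 1 + s * (p * (y - 1)).
  by have := powR_le_tangent s01 z0; rewrite /z; lra.
have t2 : z `^ s <= 1 + p `^ s * y `^ s.
  have p1' : 0 <= 1 - p by rewrite subr_ge0.
  apply: (le_trans (powR_subadditive s01 p1' (mulr_ge0 p0 (ltW y0)) z0)).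
  rewrite powRM//; last exact: ltW.
  have : (1 - p) `^ s <= 1 `^ s by rewrite ge0_ler_powR ?nnegrE//; lra.
  by rewrite powR1 lerD2r.
rewrite !powR1s//; [|exact: ltW..].
have h1 : (1 - p) * z `^ s <= (1 - p) * (1 + s * (p * (y - 1))).
  by rewrite ler_wpM2l// subr_ge0.
have h2 : p * y * z `^ s <= p * y * (1 + p `^ s * y `^ s).
  by rewrite ler_wpM2l// mulr_ge0// ltW.
by move: h1 h2; rewrite /z; lra.
Qed.

Lemma powR_prod (R : realType) (I : Type) (r : seq I) (f : I -> R) (q : R) :
  (forall i, 0 <= f i) ->
  (\prod_(i <- r) f i) `^ q = \prod_(i <- r) f i `^ q.
Proof.
move=> f0; elim: r => [|i r IH]; first by rewrite !big_nil powR1.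
by rewrite !big_cons powRM ?IH// prodr_ge0.
Qed.

Section window_likelihood.
Context (R : realType) (N T : nat) (lam : R) (lam_gt0 : 0 < lam).
Context (mass1 : forall mu : 'M[R]_(N, T), (forall n t, 0 < mu n t) ->
  \esum_(x in [set: 'M[nat]_(N, T)]) (poisson_mass mu x)%:E = 1%E).
Context (a b : R) (a_gt0 : 0 < a) (b_gt0 : 0 < b) (H M : nat)
  (MT : (2 * H * M <= T)%N) (p : 'I_N -> R) (p01 : forall n, 0 <= p n <= 1).

(** Minus the logarithm of the normalizing constant of the likelihood ratio of
one row. *)
Definition log_norm : R := lam * H%:R * (a + b - 2).

Definition row_ratio (k : nat) (x : 'M[nat]_(N, T)) (n : 'I_N) : R :=
  expR (- log_norm) * \prod_(t < T) pulse a b H k t ^+ x n t.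

(** Likelihood ratio of the mixture over the random set of changing rows. *)
Definition window_ratio (k : nat) (x : 'M[nat]_(N, T)) : R :=
  \prod_n (1 - p n + p n * row_ratio k x n).

Lemma row_ratio_gt0 k x n : 0 < row_ratio k x n.
Proof.
rewrite /row_ratio mulr_gt0 ?expR_gt0// prodr_gt0// => t _.
by rewrite exprn_gt0// pulse_gt0.
Qed.

Lemma window_ratio_ge0 k x : 0 <= window_ratio k x.
Proof.
apply: prodr_ge0 => n _; have /andP[p0 p1] := p01 n.
by rewrite addr_ge0 ?subr_ge0// mulr_ge0// ltW// row_ratio_gt0.
Qed.

Lemma prod_expR_sum (f : 'I_T -> R) :
  \prod_t expR (lam * f t) = expR (lam * \sum_t f t).
Proof. by rewrite -expR_sum mulr_sumr. Qed.

Lemma sum_pulse_sub1 (k : 'I_M) :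
  \sum_(t < T) (pulse a b H k t - 1) = H%:R * (a + b - 2).
Proof.
rewrite (@sum_pulse _ a b H k T (fun y => y - 1)) ?subrr//; first by ring.
exact: window_fits MT (ltn_ord k).
Qed.

Lemma null_mean_cst1 : null_mean lam (cst 1 : 'M[nat]_(N, T) -> R) = 1%E.
Proof.
rewrite -(@mass1 (const_mx lam)) => [|n t]; last by rewrite mxE.
by apply: eq_esum => x _; rewrite mulr1.
Qed.

Lemma null_mean_window_ratio (k : 'I_M) : null_mean lam (window_ratio k) = 1%E.
Proof.
pose c n (j : bool) := if j then p n * expR (- log_norm) else 1 - p n.
pose theta (j : bool) (t : 'I_T) := if j then pulse a b H k t else 1.
transitivity (null_mean lam (fun x : 'M[nat]_(N, T) =>
    \prod_n \sum_j c n j * \prod_t theta j t ^+ x n t)).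
  apply: eq_esum => x _; congr (_ * _)%:E; apply: eq_bigr => n _.
  rewrite big_bool /c /theta/= addrC mulrA; congr (_ + _).
  by rewrite big1 ?mulr1// => t _; rewrite expr1n.
rewrite null_mean_row_mixture//; last 2 first.
- move=> n [] /=; have /andP[p0 p1] := p01 n; last by rewrite subr_ge0.
  by rewrite mulr_ge0// expR_ge0.
- by move=> [] t //=; exact: pulse_gt0.
congr EFin; rewrite big1// => n _; rewrite big_bool /c /theta/=.
rewrite !prod_expR_sum sum_pulse_sub1 big1 => [|t _]; last by rewrite subrr.
by rewrite mulr0 expR0 -mulrA -expRD mulrA addNr expR0; ring.
Qed.

(** In a row, the two pulses never differ from 1 at the same time, so that the
exponents of their product add up: windows are independent under the null
law. *)
Lemma null_mean_window_ratioM (k l : 'I_M) : k != l ->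
  null_mean lam (fun x => window_ratio k x * window_ratio l x) = 1%E.
Proof.
move=> kl.
pose c n (j : bool) := if j then p n * expR (- log_norm) else 1 - p n.
pose theta (k : nat) (j : bool) (t : 'I_T) := if j then pulse a b H k t else 1.
have c0 n j : 0 <= c n j.
  case: j; have /andP[p0 p1] := p01 n; last by rewrite subr_ge0.
  by rewrite mulr_ge0// expR_ge0.
have th0 m j t : 0 < theta m j t by case: j => //=; exact: pulse_gt0.
have wE m x : window_ratio m x =
    \prod_n \sum_j c n j * \prod_t theta m j t ^+ x n t.
  apply: eq_bigr => n _; rewrite big_bool /c /theta/= addrC mulrA; congr (_ + _).
  by rewrite big1 ?mulr1// => t _; rewrite expr1n.
transitivity (null_mean lam (fun x : 'M[nat]_(N, T) =>
    \prod_n \sum_(j : bool * bool) c n j.1 * c n j.2 *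
      \prod_t (theta k j.1 t * theta l j.2 t) ^+ x n t)).
  apply: eq_esum => x _; congr (_ * _)%:E.
  rewrite !wE -big_split; apply: eq_bigr => n _.
  rewrite /= mulr_suml; under [LHS]eq_bigr do rewrite mulr_sumr.
  rewrite pair_bigA; apply: eq_bigr => -[i j] _ /=.
  rewrite mulrACA -big_split; congr (_ * _); apply: eq_bigr => t _.
  by rewrite exprMn.
rewrite (null_mean_row_mixture lam_gt0 mass1 (c := fun n j => c n j.1 * c n j.2)
  (theta := fun j t => theta k j.1 t * theta l j.2 t)); last 2 first.
- by move=> n j; rewrite mulr_ge0.
- by move=> j t; rewrite mulr_gt0.
have rowE (m : 'I_M) i : \prod_t expR (lam * (theta m i t - 1)) =
    if i then expR log_norm else 1.
  case: i; rewrite prod_expR_sum /theta ?sum_pulse_sub1; first by rewrite mulrA.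
  by rewrite big1 ?mulr0 ?expR0// => t _; rewrite subrr.
(* One of the two factors is 1 at each time. *)
have thetaM i j t : theta k i t * theta l j t - 1 =
    (theta k i t - 1) + (theta l j t - 1).
  case: i; case: j; rewrite /theta/=; try by ring.
  by have [->|->] := pulse_disjoint a b H t kl; ring.
congr EFin; rewrite big1// => n _.
have cE : \sum_i c n i * (if i then expR log_norm else 1) = 1.
  by rewrite big_bool /c/= mulr1 -mulrA -expRD addNr expR0; ring.
transitivity ((\sum_i c n i * (if i then expR log_norm else 1)) *
    (\sum_j c n j * (if j then expR log_norm else 1))); last by rewrite cE mulr1.
rewrite /= mulr_suml; under [RHS]eq_bigr do rewrite mulr_sumr.
rewrite pair_bigA; apply: eq_bigr => -[i j] _ /=; rewrite mulrACA; congr (_ * _).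
rewrite -(rowE k) -(rowE l) -big_split; apply: eq_bigr => t _ /=.
by rewrite thetaM mulrDr expRD.
Qed.

Lemma null_mean_window_ratio_powR (k : 'I_M) (s : R) : 0 < s <= 1 ->
  (null_mean lam (fun x => window_ratio k x `^ (1 + s))%R <=
  (\prod_n (1 + p n `^ (1 + s) * expR (lam * H%:R *
     (a `^ (1 + s) + b `^ (1 + s) - 2 - (1 + s) * (a + b - 2)))))%R%:E)%E.
Proof.
move=> s01; have /andP[s0 s1] := s01.
(* The three terms of [inclusion_power_bound]: constant, linear, power. *)
pose c n (j : option bool) := match j with
  | None => (1 - p n) * (1 - s * p n)
  | Some false => ((1 - p n) * s * p n + p n) * expR (- log_norm)
  | Some true => p n `^ (1 + s) * expR (- ((1 + s) * log_norm)) end.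
pose theta (j : option bool) (t : 'I_T) := match j with
  | None => 1
  | Some false => pulse a b H k t
  | Some true => pulse a b H k t `^ (1 + s) end.
have c0 n j : 0 <= c n j.
  have /andP[p0 p1] := p01 n; case: j => [[]|] /=.
  - by rewrite mulr_ge0 ?expR_ge0 ?powR_ge0.
  - rewrite mulr_ge0 ?expR_ge0// addr_ge0// !mulr_ge0 ?subr_ge0//; exact: ltW.
  - by rewrite mulr_ge0 ?subr_ge0//; nra.
have th0 j t : 0 < theta j t.
  by case: j => [[]|] //=; rewrite ?powR_gt0 ?pulse_gt0.
have sumO (f : option bool -> R) : \sum_j f j = f None + f (Some false) + f (Some true).
  rewrite (bigD1 None)//= (bigD1 (Some false))//= (bigD1 (Some true))//=.
  by rewrite big1 ?addr0 ?addrA// => -[[]|].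
apply: (@le_trans _ _ (null_mean lam (fun x : 'M[nat]_(N, T) =>
    \prod_n \sum_j c n j * \prod_t theta j t ^+ x n t)%R)).
  apply: le_esum => x _; rewrite lee_fin ler_wpM2l ?poisson_mass_ge0//.
  have -> : window_ratio k x `^ (1 + s) =
      \prod_n (1 - p n + p n * row_ratio k x n) `^ (1 + s).
    rewrite powR_prod// => n; have /andP[p0 p1] := p01 n.
    by rewrite addr_ge0 ?subr_ge0// mulr_ge0// ltW// row_ratio_gt0.
  apply: ler_prod => n _; rewrite powR_ge0/=.
  apply: (le_trans (inclusion_power_bound (p01 n) s01 (row_ratio_gt0 k x n))).
  rewrite sumO /c /theta; rewrite [\prod_t 1 ^+ _]big1 => [|t _]; last by rewrite expr1n.
  rewrite mulr1 /row_ratio mulrA lerD// -mulrA.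
  rewrite powRM ?expR_ge0//; last first.
    by apply: prodr_ge0 => t _; rewrite exprn_ge0// ltW// pulse_gt0.
  rewrite -expRM powR_prod => [|t]; last by rewrite exprn_ge0// ltW// pulse_gt0.
  rewrite mulrA mulNr (mulrC log_norm) le_eqVlt; apply/orP; left; apply/eqP.
  rewrite -mulrA; congr (_ * (_ * _)); apply: eq_bigr => t _.
  by rewrite -!powR_mulrn ?powR_ge0 1?powRAC// ltW// pulse_gt0.
rewrite null_mean_row_mixture// lee_fin; apply: ler_prod => n _.
have /andP[p0 p1] := p01 n.
rewrite sumr_ge0/=; last first.
  by move=> j _; rewrite mulr_ge0// prodr_ge0// => t _; exact: expR_ge0.
rewrite sumO /c /theta !prod_expR_sum sum_pulse_sub1.
rewrite big1 => [|t _]; last by rewrite subrr.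
have norm0 : - log_norm + lam * (H%:R * (a + b - 2)) = 0 by rewrite /log_norm; ring.
rewrite mulr0 expR0 -!mulrA -!expRD norm0 expR0.
rewrite (@sum_pulse _ a b H k T (fun y => y `^ (1 + s) - 1)); last 2 first.
- by rewrite powR1 subrr.
- exact: window_fits MT (ltn_ord k).
rewrite le_eqVlt; apply/orP; left; apply/eqP.
rewrite /log_norm; set A := a `^ _; set B := b `^ _.
have -> : - ((1 + s) * (lam * H%:R * (a + b - 2))) + lam * (H%:R * (A - 1 + (B - 1)))
   = lam * (H%:R * (A + B - 2 - (1 + s) * (a + b - 2))) by ring.
by ring.
Qed.

End window_likelihood.

(** * Alternatives with a change-point in the middle of a window *)

(* Keeps [mean mu n t.+1] folded under simplification. *)
Arguments mean : simpl never.

(** A change-point with no other one at distance less than [H] satisfies the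
spacing condition; the end points 0 and [T], which replace a missing neighbour,
have to be far away too. *)
Lemma tau_isolated (R : realType) (N T : nat) (mu : 'M[R]_(N, T)) (H c : nat) :
  c \in change_points mu ->
  (forall t, t \in change_points mu -> (t < c)%N -> (t + H <= c)%N) ->
  (forall t, t \in change_points mu -> (c < t)%N -> (c + H <= t)%N) ->
  (H <= c)%N -> (c + H <= T)%N ->
  exists j, [/\ (1 <= j <= num_changes mu)%N, tau mu j = c &
    (H <= minn (tau mu j.+1 - tau mu j) (tau mu j - tau mu j.-1))%N].
Proof.
rewrite /num_changes /tau; set s := change_points mu => cs before after Hc cT.
have ss : sorted ltn s by rewrite sorted_filter ?iota_ltn_sorted//; exact: ltn_trans.
pose i := index c s; have i_s : (i < size s)%N by rewrite index_mem.
have ci : nth T s i = c by exact: nth_index.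
have nth_lt u v : (u < v)%N -> (v < size s)%N -> (nth T s u < nth T s v)%N.
  move=> uv vs; apply: (sorted_ltn_nth ltn_trans) => //; rewrite inE//.
  exact: ltn_trans uv vs.
exists i.+1; split; [by rewrite ltnS i_s|by []|rewrite /= ci].
rewrite leq_min; apply/andP; split.
  have [i1|i1] := ltnP i.+1 (size s); last by rewrite nth_default//; lia.
  have := after (nth T s i.+1) (mem_nth _ i1).
  have := nth_lt i i.+1 (leqnn _) i1; rewrite ci => h1 /(_ h1); lia.
case: (posnP i) => [->|i0]; first by rewrite subn0.
rewrite -(prednK i0)/=; have i1 : (i.-1 < size s)%N by lia.
have := before (nth T s i.-1) (mem_nth _ i1).
have := nth_lt i.-1 i; rewrite ci => /(_ _ i_s) h1 h2.
have h3 : (nth T s i.-1 < c)%N by apply: h1; lia.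
by have := h2 h3; lia.
Qed.

Lemma meanS (R : realType) (N T : nat) (mu : 'M[R]_(N, T)) (n : 'I_N) (t : nat)
    (tT : (t < T)%N) : mean mu n t.+1 = mu n (Ordinal tT).
Proof. by rewrite /mean insubT. Qed.

Definition pulse_mean (R : realType) (N T : nat) (lam a b : R) (H k : nat)
    (S : {set 'I_N}) : 'M[R]_(N, T) :=
  \matrix_(n, t) (lam * (if n \in S then pulse a b H k t else 1)).

(** The other change-points of this array can only be the two ends of the
window. *)
Lemma pulse_mean_Lambda1 (R : realType) (N T : nat) (mu0 lam Delta h : R)
    (V H k : nat) (S : {set 'I_N}) :
  0 < mu0 -> mu0 <= lam -> 0 < Delta -> (0 < H)%N -> h <= H%:R ->
  (2 * H * k + 2 * H <= T)%N -> (0 < V)%N -> (V <= #|S|)%N ->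
  Lambda1 mu0 Delta V h
    (@pulse_mean R N T lam (mu0 / lam) (expR Delta * mu0 / lam) H k S).
Proof.
move=> mu00 mulam D0 H0 hH kT V0 VS; set mu := pulse_mean _ _ _ _ _ _ _.
have lam0 : 0 < lam := lt_le_trans mu00 mulam.
have r1 : 1 < expR Delta by rewrite expR_gt1.
have lama : lam * (mu0 / lam) = mu0 by rewrite mulrCA mulfV ?mulr1// gt_eqF.
have lamb : lam * (expR Delta * mu0 / lam) = expR Delta * mu0.
  by rewrite mulrCA mulfV ?mulr1// gt_eqF.
have muE n t : (t < T)%N -> mean mu n t.+1 =
    lam * (if n \in S then pulse (mu0 / lam) (expR Delta * mu0 / lam) H k t else 1).
  by move=> tT; rewrite meanS mxE.
pose c := (2 * H * k + H)%N.
have mean_low n t : n \in S -> (2 * H * k <= t < c)%N -> mean mu n t.+1 = mu0.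
  by move=> nS tc; rewrite muE ?nS /pulse ?tc ?lama//; rewrite /c in tc; lia.
have mean_high n t : n \in S -> (c <= t < 2 * H * k + 2 * H)%N ->
    mean mu n t.+1 = expR Delta * mu0.
  move=> nS tc; rewrite muE ?nS /pulse; last by rewrite /c in tc; lia.
  by rewrite ifF ?tc ?lamb//; apply/negbTE; rewrite /c in tc; lia.
have mean_out n t : n \notin S -> (t < T)%N -> mean mu n t.+1 = lam.
  by move=> nS tT; rewrite muE// (negbTE nS) mulr1.
have c0 : c = c.-1.+1 by rewrite /c; lia.
have mean_c n : n \in S -> mean mu n c = mu0.
  by move=> nS; rewrite c0 mean_low// /c; lia.
have mean_c1 n : n \in S -> mean mu n c.+1 = expR Delta * mu0.
  by move=> nS; rewrite mean_high// /c; lia.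
have cpE t : (t \in change_points mu) =
    [exists n, mean mu n t != mean mu n t.+1] && (1 <= t < 1 + T.-1)%N.
  by rewrite mem_filter mem_iota.
have c_cp : c \in change_points mu.
  rewrite cpE; apply/andP; split; last by rewrite /c; lia.
  have /card_gt0P[n nS] : (0 < #|S|)%N by exact: leq_trans VS.
  by apply/existsP; exists n; rewrite mean_c// mean_c1//; nra.
split.
  move=> n t; rewrite mxE; case: ifP => _; last by rewrite mulr1.
  rewrite /pulse; case: ifP => _; first by rewrite lama.
  by case: ifP => _; rewrite ?mulr1// lamb ler_peMl// ltW.
have nochange t : (2 * H * k < t < 2 * H * k + 2 * H)%N -> t != c ->
    t \notin change_points mu.
  move=> tr tc; rewrite cpE negb_and; apply/orP; left.
  rewrite negb_exists; apply/forallP => n; rewrite negbK; apply/eqP.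
  have t0 : t = t.-1.+1 by lia.
  have [nS|nS] := boolP (n \in S); last first.
    by rewrite {1}t0 !mean_out//; lia.
  have [ltc|] := ltnP t c; first by rewrite {1}t0 !mean_low//; lia.
  move=> ct; have ltc : (c < t)%N by rewrite ltn_neqAle eq_sym tc.
  by rewrite {1}t0 !mean_high//; lia.
have [||||j [jr tauj Hj]] := @tau_isolated _ _ _ mu H c c_cp.
- move=> t tcp tc; rewrite leqNgt; apply/negP => tH; move: tcp; apply/negP.
  by apply: nochange; move: tc tH; rewrite /c; [lia|rewrite neq_ltn => ->].
- move=> t tcp tc; rewrite leqNgt; apply/negP => tH; move: tcp; apply/negP.
  by apply: nochange; move: tc tH; rewrite /c; [lia|rewrite neq_ltn => ->; rewrite orbT].
- by rewrite /c; lia.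
- by rewrite /c; lia.
exists j; split => //; first by apply: (le_trans hH); rewrite ler_nat.
apply: (leq_trans VS); apply: subset_leq_card; apply/fintype.subsetP => n nS.
rewrite inE /mkset tauj mean_c// mean_c1// -mulrA mulfV ?gt_eqF// mulr1 expRK.
by rewrite ger0_norm// ltW.
Qed.

Lemma const_Lambda0 (R : realType) (N T : nat) (mu0 lam : R) :
  mu0 <= lam -> Lambda0 mu0 (const_mx lam : 'M[R]_(N, T)).
Proof.
move=> mulam; split; first by move=> n t; rewrite mxE.
rewrite /num_changes; apply/eqP; rewrite size_eq0 -(negbK (_ == _)) -has_filter.
rewrite -all_predC; apply/allP => t; rewrite mem_iota => tT /=.
rewrite negb_exists; apply/forallP => n; rewrite negbK.
case: t tT => [//|t] tT; have [t0 t1] : (t < T)%N /\ (t.+1 < T)%N by split; lia.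
by rewrite (meanS _ _ t0) (meanS _ _ t1) !mxE.
Qed.

Definition inclusion_weight (R : realType) (N : nat) (p : 'I_N -> R)
    (S : {set 'I_N}) : R :=
  \prod_n (if n \in S then p n else 1 - p n).

Lemma inclusion_weight_ge0 (R : realType) (N : nat) (p : 'I_N -> R) S :
  (forall n, 0 <= p n <= 1) -> 0 <= inclusion_weight p S.
Proof.
move=> p01; apply: prodr_ge0 => n _; have /andP[p0 p1] := p01 n.
by case: ifP; rewrite ?subr_ge0.
Qed.

(** Choosing one term in each factor of the product amounts to choosing the
set [S]. *)
Lemma sum_inclusion_weight (R : realType) (N : nat) (p y : 'I_N -> R) :
  \prod_n (1 - p n + p n * y n) =
  \sum_(S : {set 'I_N}) inclusion_weight p S * \prod_n (if n \in S then y n else 1).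
Proof.
under eq_bigr do rewrite addrC.
rewrite bigA_distr; apply: eq_bigr => S _.
by rewrite -big_split; apply: eq_bigr => n _ /=; case: ifP; rewrite ?mulr1.
Qed.

(** Chernoff's bound with base 16: the left-hand side of the hypothesis is [16 ^ V]
times the mean of [16 ^ (- #|S|)], and [#|S| < V] leaves a spare factor 16. *)
Lemma inclusion_tail (R : realType) (N V : nat) (p : 'I_N -> R) :
  (forall n, 0 <= p n <= 1) ->
  16 ^+ V * \prod_n (1 - 15 / 16 * p n) <= 1 ->
  \sum_(S : {set 'I_N} | (#|S| < V)%N) inclusion_weight p S <= 16^-1.
Proof.
move=> p01 pV.
have -> : 16^-1 = 16^-1 * 1 :> R by rewrite mulr1.
apply: le_trans (ler_wpM2l _ pV); last by [].
rewrite (eq_bigr (fun n => 1 - p n + p n * 16^-1)) => [|n _]; last by lra.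
rewrite (sum_inclusion_weight p (fun=> 16^-1)) !mulr_sumr.
rewrite [leLHS]big_mkcond; apply: ler_sum => S _.
have w0 := inclusion_weight_ge0 S p01.
have -> : \prod_n (if n \in S then 16^-1 else 1) = 16 ^- #|S| :> R.
  by rewrite -big_mkcond prodr_const exprVn.
case: ifP => SV; last by rewrite !mulr_ge0// ?exprn_ge0// invr_ge0 exprn_ge0.
have [m ->] : exists m, V = (m + #|S|.+1)%N by exists (V - #|S|.+1)%N; lia.
have -> : 16^-1 * (16 ^+ (m + #|S|.+1) * (inclusion_weight p S * 16 ^- #|S|)) =
    16 ^+ m * inclusion_weight p S.
  by rewrite exprD exprS; field; rewrite expf_neq0.
by rewrite ler_peMl// exprn_ege1// ler1n.
Qed.

(** [row_ratio] is indeed the likelihood ratio of a changing row. *)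
Lemma poisson_mass_pulse_mean (R : realType) (N T : nat) (lam a b : R) (H k : nat)
    (S : {set 'I_N}) (x : 'M[nat]_(N, T)) :
  0 < lam -> 0 < a -> 0 < b -> (2 * H * k + 2 * H <= T)%N ->
  poisson_mass (pulse_mean T lam a b H k S) x =
  poisson_mass (const_mx lam) x *
    \prod_n (if n \in S then row_ratio lam a b H k x n else 1).
Proof.
move=> lam0 a0 b0 kT.
pose theta (n : 'I_N) (t : 'I_T) := if n \in S then pulse a b H k t else 1.
have th0 n t : 0 < theta n t by rewrite /theta; case: ifP => // _; exact: pulse_gt0.
have e : \prod_n \prod_t expR (lam * (theta n t - 1)) =
    \prod_n (if n \in S then expR (log_norm lam a b H) else 1).
  apply: eq_bigr => n _; rewrite prod_expR_sum /theta; case: ifP => nS.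
    rewrite (@sum_pulse _ a b H k T (fun y => y - 1)) ?subrr// /log_norm.
    by congr expR; ring.
  by rewrite big1 ?mulr0 ?expR0// => t _; rewrite subrr.
have := poisson_mass_tilt lam0 x th0; rewrite e => tilt.
rewrite (eq_bigr (fun n => (if n \in S then expR (- log_norm lam a b H) else 1) *
   \prod_t theta n t ^+ x n t)); last first.
  move=> n _; rewrite /row_ratio /theta; case: ifP => // _.
  by rewrite big1 ?mulr1// => t _; rewrite expr1n.
rewrite big_split mulrCA tilt mulrA -big_split big1 ?mul1r// => n _ /=.
by case: ifP => _; rewrite ?mulr1// -expRD addNr expR0.
Qed.

(** * Lower bound on the sum of the two error probabilities *)

Section risk.
Context (R : realType) (d : measure_display) (Omega : measurableType d)
  (N T : nat) (P : 'M[R]_(N, T) -> probability Omega R)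
  (X : Omega -> 'M[nat]_(N, T)) (test : 'M[nat]_(N, T) -> bool).

Context (model : poisson_model P X).

Lemma fine_prob_le1 mu (A : set 'M[nat]_(N, T)) :
  fine (P mu [set w | A (X w)]) <= 1.
Proof.
have mA := poisson_model_measurable model A.
by rewrite -lee_fin fineK ?probability_le1//; exact: fin_num_measure.
Qed.

Lemma sup_type1_error_ge (H0 : set 'M[R]_(N, T)) mu : H0 mu ->
  fine (P mu [set w | test (X w)]) <= sup_type1_error P X H0 test.
Proof.
move=> H0mu; apply: ub_le_sup; last by exists mu.
by exists 1 => _ [nu _ <-]; exact: (fine_prob_le1 nu [set x | test x]).
Qed.

Lemma sup_type2_error_ge (H1 : set 'M[R]_(N, T)) mu : H1 mu ->
  fine (P mu [set w | ~~ test (X w)]) <= sup_type2_error P X H1 test.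
Proof.
move=> H1mu; apply: ub_le_sup; last by exists mu.
by exists 1 => _ [nu _ <-]; exact: (fine_prob_le1 nu [set x | ~~ test x]).
Qed.

Lemma sup_type2_error_ge0 (H1 : set 'M[R]_(N, T)) :
  0 <= sup_type2_error P X H1 test.
Proof.
have [->|/set0P[mu H1mu]] := eqVneq H1 set0.
  by rewrite /sup_type2_error image_set0 sup0.
by apply: le_trans (sup_type2_error_ge H1mu); rewrite fine_ge0.
Qed.

Lemma model_total (mu : 'M[R]_(N, T)) : (forall n t, 0 < mu n t) ->
  \esum_(x in [set: 'M[nat]_(N, T)]) (poisson_mass mu x)%:E = 1%E.
Proof.
move=> mu0; rewrite -(poisson_model_law model setT mu0) -[RHS](probability_setT (P mu)).
by congr (P mu _); apply/seteqP; split.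
Qed.

Lemma model_prob_test (mu : 'M[R]_(N, T)) (A : pred 'M[nat]_(N, T)) :
  (forall n t, 0 < mu n t) ->
  (\esum_(x in [set: 'M[nat]_(N, T)]) (poisson_mass mu x * (A x)%:R)%:E =
   (fine (P mu [set w | A (X w)]))%:E)%E.
Proof.
move=> mu0; rewrite fineK; last first.
  by apply: fin_num_measure; exact: (poisson_model_measurable model [set x | A x]).
rewrite (poisson_model_law model [set x | A x] mu0) [RHS]esum_mkcond.
apply: eq_esum => x _; have [Ax|/negbTE Ax] := boolP (A x).
  by rewrite mem_set// mulr1.
by rewrite memNset ?mulr0//= Ax.
Qed.

(** The truncation level is [M / 8]; the constant is
[3 / 4 - 1 / 8 - 1 / 16], the last term being the prior probability that too few
rows change. *)
Lemma risk_lower_bound (mu0 lam Delta h s : R) (V H M : nat) (p : 'I_N -> R) :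
  let a := mu0 / lam in let b := expR Delta * mu0 / lam in
  0 < mu0 -> mu0 <= lam -> 0 < Delta -> 0 < s <= 1 ->
  (0 < H)%N -> h <= H%:R -> (0 < M)%N -> (2 * H * M <= T)%N -> (0 < V)%N ->
  (forall n, 0 <= p n <= 1) -> 16 ^+ V * \prod_n (1 - 15 / 16 * p n) <= 1 ->
  9 / 16 - 2 * (M%:R / 8) `^ (- s) *
    (\prod_n (1 + p n `^ (1 + s) * expR (lam * H%:R *
       (a `^ (1 + s) + b `^ (1 + s) - 2 - (1 + s) * (a + b - 2))))) <=
  sup_type1_error P X (Lambda0 mu0) test +
  sup_type2_error P X (Lambda1 mu0 Delta V h) test.
Proof.
move=> a b mu00 mulam D0 s01 H0 hH M0 MT V0 p01 pV.
have lam0 : 0 < lam := lt_le_trans mu00 mulam.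
have a0 : 0 < a by rewrite divr_gt0.
have b0 : 0 < b by rewrite divr_gt0// mulr_gt0// expR_gt0.
have M0R : 0 < M%:R :> R by rewrite ltr0n.
have c0 : 0 < M%:R / 8 :> R by rewrite divr_gt0.
have kT (k : 'I_M) : (2 * H * k + 2 * H <= T)%N by exact: window_fits MT (ltn_ord k).
pose alt (k : 'I_M) (S : {set 'I_N}) := pulse_mean T lam a b H k S.
have alt0 k S n t : 0 < alt k S n t.
  by rewrite mxE mulr_gt0//; case: ifP => // _; exact: pulse_gt0.
pose e (k : 'I_M) (S : {set 'I_N}) := fine (P (alt k S) [set w | ~~ test (X w)]).
have e0 k S : 0 <= e k S by rewrite fine_ge0.
have e1 k S : e k S <= 1 by exact: (fine_prob_le1 _ [set x | ~~ test x]).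
set err1 := sup_type1_error _ _ _ _; set err2 := sup_type2_error _ _ _ _.
have err20 : 0 <= err2 by exact: sup_type2_error_ge0.
have wsum : \sum_(S : {set 'I_N}) inclusion_weight p S = 1.
  transitivity (\prod_n (1 - p n + p n * 1)); last first.
    by rewrite big1// => n _; ring.
  rewrite (sum_inclusion_weight p (fun=> 1)); apply: eq_bigr => S _.
  by rewrite big1 ?mulr1// => n _; case: ifP.
have w0 S := inclusion_weight_ge0 S p01.
have prior (k : 'I_M) : \sum_(S : {set 'I_N}) inclusion_weight p S * e k S <= err2 + 16^-1.
  apply: le_trans (lerD (lexx err2) (inclusion_tail p01 pV)).
  rewrite (bigID (fun S : {set 'I_N} => (#|S| < V)%N))/= addrC lerD//.
    rewrite -[err2]mulr1 -wsum mulr_sumr [leRHS](bigID (fun S : {set 'I_N} => (#|S| < V)%N))/=.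
    rewrite ler_wpDl//; first by apply: sumr_ge0 => S _; exact: mulr_ge0.
    apply: ler_sum => S; rewrite -leqNgt => VS; rewrite mulrC ler_wpM2r//.
    apply: sup_type2_error_ge; exact: pulse_mean_Lambda1.
  by apply: ler_sum => S _; rewrite ler_piMr.
set B := \prod_n _.
have M1 : 0 < M%:R^-1 :> R by rewrite invr_gt0.
have main := @mixture_testing_lower_bound R _ (poisson_mass (const_mx lam)) M
  (fun k => window_ratio lam a b H p k) test (M%:R / 8) s B
  (poisson_mass_ge0 (const_mx lam)) M0
  (fun k x => window_ratio_ge0 lam a0 b0 H p01 k x) c0 _ _ _ _ _.
have {}main : ((3 / 4 - M%:R / 8 / M%:R - 2 * (M%:R / 8) `^ (- s) * B)%R%:E <=
   (err1 + (err2 + 16^-1))%:E)%E.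
  apply: (le_trans (main _ _ _ _ _)).
  - by have /andP[/ltW] := s01.
  - exact: null_mean_cst1 model_total.
  - move=> k; exact: (null_mean_window_ratio lam0 model_total a0 b0 MT p01 k).
  - move=> k l; exact: (null_mean_window_ratioM lam0 model_total a0 b0 MT p01).
  - move=> k.
    exact: (null_mean_window_ratio_powR lam0 model_total a0 b0 MT p01 k s01).
  rewrite EFinD; apply: leeD.
    rewrite model_prob_test ?lee_fin => [|n t]; last by rewrite mxE.
    by apply: sup_type1_error_ge; exact: const_Lambda0.
  have -> : (err2 + 16^-1)%:E = (\sum_(k < M) (M%:R^-1 * (err2 + 16^-1))%:E)%E.
    rewrite sumEFin sumr_const card_ord -[(_ * _) *+ M]mulr_natl mulrA mulfV ?mul1r//.
    by rewrite gt_eqF.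
  rewrite (_ : esum _ _ = (\sum_(k < M) (M%:R^-1 *
     \sum_(S : {set 'I_N}) inclusion_weight p S * e k S)%:E)%E).
    by apply: lee_sum => k _; rewrite lee_fin ler_wpM2l// ltW.
  have e0E k S : (0 <= (M%:R^-1 * (inclusion_weight p S * e k S))%:E)%E.
    by rewrite lee_fin !mulr_ge0// ltW.
  pose f (k : 'I_M) (S : {set 'I_N}) (x : 'M[nat]_(N, T)) : R :=
    (M%:R^-1 * inclusion_weight p S) * (poisson_mass (alt k S) x * (~~ test x)%:R).
  have f0 k S x : (0 <= (f k S x)%:E)%E.
    by rewrite /f lee_fin !mulr_ge0// ?poisson_mass_ge0// ltW.
  transitivity (\esum_(x in [set: 'M[nat]_(N, T)])
     (\sum_(k < M) \sum_(S : {set 'I_N}) (f k S x)%:E)%E).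
    apply: eq_esum => x _; under [RHS]eq_bigr do rewrite sumEFin.
    rewrite sumEFin; congr EFin.
    rewrite mulrA mulrCA !mulr_sumr; apply: eq_bigr => k _.
    rewrite /window_ratio sum_inclusion_weight !mulr_sumr; apply: eq_bigr => S _.
    rewrite /f /alt (poisson_mass_pulse_mean S x lam0 a0 b0 (kT k)). ring.
  rewrite esum_sum => [|x k _ _]; last by apply: sume_ge0.
  apply: eq_bigr => k _; rewrite esum_sum// mulr_sumr -sumEFin.
  apply: eq_bigr => S _; under eq_esum => x _ do rewrite /f EFinM.
  rewrite esumZl//; last 2 first.
  - by rewrite mulr_ge0// ltW.
  - by move=> x; rewrite lee_fin mulr_ge0// poisson_mass_ge0.
  by rewrite (model_prob_test (fun x => ~~ test x))// -EFinM mulrA.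
rewrite lee_fin in main.
have : M%:R / 8 / M%:R = 8^-1 :> R by rewrite mulrC mulrA mulVf ?mul1r// gt_eqF.
by move=> Me; rewrite Me in main; lra.
Qed.

End risk.

(** * The lower bound in logarithmic form *)

(** Reduction to logarithms: the window length is [O(ln T)], hence the number of
windows is at least [T ^ (1 - sigma / 2)] up to a constant, and a moment of size
[T ^ ((1 - sigma) * s)] is negligible against the power [s] of this number. The last
two hypotheses say that [T] is large. *)
Lemma risk_ge_of_log_bounds (R : realType) (d : measure_display)
    (Omega : measurableType d) (N T : nat)
    (P : 'M[R]_(N, T) -> probability Omega R) (X : Omega -> 'M[nat]_(N, T))
    (test : 'M[nat]_(N, T) -> bool) (mu0 lam Delta h s C sigma : R) (V H : nat)
    (p : 'I_N -> R) :
  let a := mu0 / lam in let b := expR Delta * mu0 / lam in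
  let l := ln T%:R in
  poisson_model P X ->
  0 < mu0 -> mu0 <= lam -> 0 < Delta -> 0 < s <= 1 ->
  (0 < H)%N -> h <= H%:R -> (0 < V)%N ->
  (forall n, 0 <= p n <= 1) -> 16 ^+ V * \prod_n (1 - 15 / 16 * p n) <= 1 ->
  0 < C -> 0 < sigma < 1 -> H%:R <= C * l ->
  \prod_n (1 + p n `^ (1 + s) * expR (lam * H%:R *
       (a `^ (1 + s) + b `^ (1 + s) - 2 - (1 + s) * (a + b - 2)))) <=
    expR ((1 - sigma) * s * l) ->
  2 * ln (64 * C / sigma) <= l ->
  ln (64 * C / sigma) + ln 8 / s <= sigma / 2 * l ->
  5 / 16 <= sup_type1_error P X (Lambda0 mu0) test +
            sup_type2_error P X (Lambda1 mu0 Delta V h) test.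
Proof.
move=> a b l model mu00 mulam D0 s01 H0 hH V0 p01 pV C0 /andP[sg0 sg1] HC Bl l1 l2.
have /andP[s0 s1] := s01.
have HR0 : 0 < H%:R :> R by rewrite ltr0n.
have l0 : 0 < l by rewrite -(pmulr_rgt0 _ C0); exact: lt_le_trans HC.
have T0 : 0 < T%:R :> R.
  rewrite ltr0n lt0n; apply/negP => /eqP T0; move: l0.
  by rewrite /l T0 ln0// ltxx.
(* [ln y <= y] at [y = sigma / 2 * l]: the logarithm of the window length only
   costs half of the gap [sigma]. *)
have logH : ln (32 * H%:R) <= sigma / 2 * l + ln (64 * C / sigma).
  have si0 : 0 < sigma^-1 by rewrite invr_gt0.
  have h1 : ln (sigma / 2 * l) <= sigma / 2 * l.
    by apply: ltW; apply: ln_sublinear; rewrite !mulr_gt0// invr_gt0.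
  apply: (@le_trans _ _ (ln (sigma / 2 * l) + ln (64 * C / sigma))); last first.
    by rewrite lerD2r.
  rewrite -lnM ?posrE ?divr_gt0 ?mulr_gt0 ?divr_gt0//.
  rewrite ler_ln ?posrE ?mulr_gt0 ?divr_gt0 ?mulr_gt0//.
  have -> : sigma / 2 * l * (64 * C / sigma) = 32 * (C * l).
    by field; rewrite gt_eqF.
  by rewrite ler_wpM2l.
have HT : 32 * H%:R <= T%:R :> R.
  rewrite -ler_ln ?posrE ?mulr_gt0//; apply: (le_trans logH).
  have : sigma * l <= 1 * l by rewrite ler_wpM2r// ltW.
  rewrite -/l; lra.
pose M := (T %/ (2 * H))%N.
have HTn : (2 * H <= T)%N by rewrite -(ler_nat R) natrM; lra.
have M0 : (0 < M)%N by rewrite divn_gt0// muln_gt0.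
have MT : (2 * H * M <= T)%N by rewrite mulnC leq_divM.
have MR0 : 0 < M%:R :> R by rewrite ltr0n.
have TM : T%:R <= 4 * H%:R * M%:R :> R.
  rewrite -[4]/(4%:R) -!natrM ler_nat.
  have := ltn_ceil T (_ : 0 < 2 * H)%N; rewrite muln_gt0 H0 => /(_ isT).
  rewrite -/M => h1; apply: ltnW; apply: (leq_trans h1).
  rewrite (_ : 4 * H * M = (2 * M) * (2 * H))%N; last by ring.
  by apply: leq_mul => //; rewrite mul2n -addnn -[X in (X < _)%N]addn0 ltn_add2l.
have logM : l - ln (32 * H%:R) <= ln (M%:R / 8).
  rewrite lerBlDr -lnM ?posrE ?divr_gt0 ?mulr_gt0//.
  rewrite ler_ln ?posrE ?divr_gt0 ?mulr_gt0 ?divr_gt0//; lra.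
apply: le_trans (risk_lower_bound test model mu00 mulam D0 s01 H0 hH M0 MT V0 p01 pV).
rewrite -/a -/b; set B := \prod_n _ in Bl *.
have c0 : 0 < M%:R / 8 :> R by rewrite divr_gt0.
have : (M%:R / 8) `^ (- s) * B <= 8^-1.
  apply: (@le_trans _ _ (expR (- s * ln (M%:R / 8)) * expR ((1 - sigma) * s * l))).
    by rewrite /powR gt_eqF// ler_wpM2l ?expR_ge0.
  rewrite -expRD -[leRHS]lnK ?posrE ?invr_gt0// ler_expR lnV ?posrE//.
  have : s * (ln (64 * C / sigma) + ln 8 / s) <= s * (sigma / 2 * l).
    by rewrite ler_wpM2l// ltW.
  rewrite mulrDr (mulrC s (_ / s)) divfK ?gt_eqF// => h1.
  have : s * (l - (sigma / 2 * l + ln (64 * C / sigma))) <= s * ln (M%:R / 8).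
    rewrite ler_wpM2l//; first exact: ltW.
    apply: le_trans logM; lra.
  lra.
move=> h1; rewrite -mulrA; lra.
Qed.

Lemma truncn_window (R : realType) (h : R) :
  exists H : nat, [/\ (0 < H)%N, h <= H%:R & H%:R <= Num.max h 0 + 1].
Proof.
exists (Num.truncn (Num.max h 0)).+1; split => //.
  apply: (@le_trans _ _ (Num.max h 0)); first by rewrite le_max lexx.
  exact/ltW/truncnS_gt.
by rewrite -natr1 lerD2r truncn_le le_max lexx orbT.
Qed.

(** * Exponents of the two regimes *)

(** [I_rate r] is a sum of two Kullback-Leibler divergences between Poisson laws;
its sign comes from [ln y < y - 1] at [(r + 1) / (2 * r)] and at
[(r + 1) / 2]. *)
Lemma I_rate_gt0 (R : realType) (r : R) : 1 < r -> 0 < I_rate r.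
Proof.
move=> r1; have r0 : 0 < r := lt_trans ltr01 r1.
have r10 : 0 < r + 1 by rewrite addr_gt0.
have ln_lt (y : R) : 0 < y -> y != 1 -> ln y < y - 1.
  move=> y0 yN1; have : ln y != 0 by rewrite ln_eq0.
  by move=> /expR_gt1Dx; rewrite lnK//; lra.
have h1 := ln_lt ((r + 1) / (2 * r)); have h2 := ln_lt ((r + 1) / 2).
have e1 : (r + 1) / (2 * r) - 1 = - (r - 1) / (2 * r).
  by field; rewrite gt_eqF.
rewrite /I_rate (_ : 2 * r / (r + 1) = ((r + 1) / (2 * r))^-1); last first.
  by rewrite invf_div.
rewrite (_ : 2 / (r + 1) = ((r + 1) / 2)^-1); last by rewrite invf_div.
rewrite !lnV ?posrE ?divr_gt0// ?mulr_gt0//.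
have {}h2 : ln ((r + 1) / 2) < (r + 1) / 2 - 1.
  apply: h2; first by rewrite divr_gt0.
  by apply/eqP => e; lra.
have {}h1 : r * ln ((r + 1) / (2 * r)) < r * ((r + 1) / (2 * r) - 1).
  rewrite ltr_pM2l//; apply: h1; first by rewrite divr_gt0 ?mulr_gt0.
  apply/eqP => e; move: e1; rewrite e subrr => /esym/eqP.
  rewrite mulf_eq0 invr_eq0 => /orP[] /eqP; lra.
have e2 : r * ((r + 1) / (2 * r) - 1) = - (r - 1) / 2.
  by rewrite e1; field; rewrite gt_eqF.
rewrite e2 in h1; lra.
Qed.

Lemma expR_le_quadratic (R : realType) (x : R) :
  `|x| <= 2^-1 -> expR x <= 1 + x + 2 * x ^+ 2.
Proof.
rewrite ler_norml => /andP[x1 x2]; have := expR_ge1Dx (- x).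
rewrite expRN => h; have e0 := expR_gt0 x.
have h1 : (1 - x) * expR x <= 1.
  by have := ler_wpM2r (ltW e0) h; rewrite mulVf// gt_eqF.
have h2 : 1 <= (1 - x) * (1 + x + 2 * x ^+ 2).
  have : 0 <= x ^+ 2 * (1 - 2 * x) by rewrite mulr_ge0 ?sqr_ge0//; lra.
  by nra.
by rewrite -(@ler_pM2l _ (1 - x)); [exact: le_trans h1 h2|lra].
Qed.

Lemma powR_le_quadratic (R : realType) (a s : R) : 0 < a -> 0 <= s ->
  s * `|ln a| <= 2^-1 ->
  a `^ (1 + s) <= a + s * (a * ln a) + s ^+ 2 * (2 * a * ln a ^+ 2).
Proof.
move=> a0 s0 sa; rewrite powRD ?(gt_eqF a0) ?implybT// powRr1; last exact: ltW.
rewrite -{2}(lnK a0) -expRM.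
have : expR (ln a * s) <= 1 + ln a * s + 2 * (ln a * s) ^+ 2.
  by apply: expR_le_quadratic; rewrite normrM (ger0_norm s0) mulrC.
by move=> /(ler_wpM2l (ltW a0)); rewrite exprMn; lra.
Qed.

(** The midpoint makes [a + b = 2], so that the exponent vanishes at [s = 0]; its
derivative there is [mu0 * I_rate r], and [s] is taken small enough for the
quadratic remainder to be at most a proportion [eps] of the linear term. *)
Lemma midpoint_exponent (R : realType) (r mu0 eps : R) :
  let lam := (r + 1) / 2 * mu0 in let a := mu0 / lam in let b := r * mu0 / lam in
  1 < r -> 0 < mu0 -> 0 < eps -> exists s, 0 < s <= 1 /\
  lam * (a `^ (1 + s) + b `^ (1 + s) - 2 - (1 + s) * (a + b - 2)) <=
    mu0 * (s * I_rate r * (1 + eps)).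
Proof.
move=> lam a b r1 mu00 eps0.
have r0 : 0 < r := lt_trans ltr01 r1.
have r10 : 0 < r + 1 by rewrite addr_gt0.
have aE : a = 2 / (r + 1) by rewrite /a /lam; field; rewrite !gt_eqF.
have bE : b = 2 * r / (r + 1) by rewrite /b /lam; field; rewrite !gt_eqF.
have a0 : 0 < a by rewrite aE divr_gt0.
have b0 : 0 < b by rewrite bE divr_gt0 ?mulr_gt0.
have ab2 : a + b - 2 = 0 by rewrite aE bE; field; rewrite gt_eqF.
have I0 := I_rate_gt0 r1.
have lp0 : 0 < (r + 1) / 2 by rewrite divr_gt0.
have IE : I_rate r = (r + 1) / 2 * (a * ln a + b * ln b).
  have -> : (r + 1) / 2 * (a * ln a + b * ln b) = ln a + r * ln b.
    by rewrite aE bE; field; rewrite gt_eqF.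
  by rewrite /I_rate -bE -aE addrC.
pose Q := (r + 1) / 2 * (2 * a * ln a ^+ 2 + 2 * b * ln b ^+ 2).
have Q0 : 0 <= Q.
  by rewrite mulr_ge0 ?(ltW lp0)// addr_ge0// mulr_ge0 ?sqr_ge0// mulr_ge0// ltW.
pose L := 1 + `|ln a| + `|ln b|.
have La : `|ln a| <= L by rewrite /L; have := normr_ge0 (ln b); lra.
have Lb : `|ln b| <= L by rewrite /L; have := normr_ge0 (ln a); lra.
have L1 : 1 <= L by rewrite /L -addrA lerDl addr_ge0.
pose s := Num.min ((2 * L)^-1) (eps * I_rate r / (Q + 1)).
have s0 : 0 < s.
  rewrite lt_min invr_gt0 mulr_gt0 ?divr_gt0 ?mulr_gt0//; lra.
have sL : s * L <= 2^-1.
  have : s <= (2 * L)^-1 by rewrite ge_min lexx.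
  rewrite invfM => h; rewrite -ler_pdivlMr//; lra.
have sQ : s * Q <= eps * I_rate r.
  apply: (@le_trans _ _ (s * (Q + 1))); first by rewrite ler_wpM2l//; lra.
  by rewrite -ler_pdivlMr; [rewrite ge_min lexx orbT|lra].
exists s; split.
  by rewrite s0/=; nra.
rewrite ab2 mulr0 subr0.
have ha : s * `|ln a| <= 2^-1.
  by apply: le_trans sL; rewrite ler_wpM2l// ltW.
have hb : s * `|ln b| <= 2^-1.
  by apply: le_trans sL; rewrite ler_wpM2l// ltW.
have := powR_le_quadratic a0 (ltW s0) ha; have := powR_le_quadratic b0 (ltW s0) hb.
set A := a `^ _; set B := b `^ _ => hB hA.
rewrite /lam mulrAC [leRHS]mulrC ler_pM2r//.
have h : (r + 1) / 2 * (A + B - 2) <= s * I_rate r + s * (s * Q).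
  rewrite IE /Q; have : A + B - 2 <= s * (a * ln a + b * ln b) +
      s ^+ 2 * (2 * a * ln a ^+ 2 + 2 * b * ln b ^+ 2) by lra.
  by move=> /(ler_wpM2l (ltW lp0)); lra.
apply: (le_trans h).
have := ler_wpM2l (ltW s0) sQ; lra.
Qed.

(** The supremum need not be known to be finite: [om = 2] gives a positive
value, which serves when the supremum is not positive, and otherwise
[(1 - eps) * rho_fun] lies strictly below the supremum. *)
Lemma rho_fun_witness (R : realType) (r beta zeta eps : R) :
  1 < r -> 0 < beta -> 1 - zeta < 2 * beta -> 0 < eps < 1 ->
  exists om w : R, [/\ (1 - zeta) / beta < om <= 2, 0 <= w,
    (1 - eps) * rho_fun r beta zeta <= w &
    w < (beta - om^-1 * (1 - zeta)) / (2 * g_fun r om - 1 - r)].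
Proof.
move=> r1 beta0 b1 /andP[e0 e1]; have r0 : 0 < r := lt_trans ltr01 r1.
pose val w := (beta - w^-1 * (1 - zeta)) / (2 * g_fun r w - 1 - r).
pose E := [set val w | w in `](1 - zeta) / beta, 2]%classic].
have E2 : E (val 2).
  by exists 2 => //=; rewrite in_itv/= lexx andbT ltr_pdivrMr//; lra.
have g2 : (1 + r) < 2 * g_fun r 2.
  have gE : g_fun r 2 ^+ 2 = (1 + r ^+ 2) / 2.
    rewrite /g_fun -powR_mulrn ?powR_ge0// -powRrM mulVf//.
    by rewrite (powR_mulrn 2) ?(ltW r0)// powRr1// divr_ge0// addr_ge0 ?sqr_ge0.
  have g0 : 0 <= g_fun r 2 by exact: powR_ge0.
  have : 0 < (r - 1) ^+ 2 by rewrite exprn_even_gt0//= subr_eq0 gt_eqF.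
  rewrite ltNge => h; apply/negP => h2.
  have : (2 * g_fun r 2) ^+ 2 <= (1 + r) ^+ 2 by rewrite ler_sqr ?nnegrE//; lra.
  rewrite exprMn gE; nra.
have val2 : 0 < val 2 by rewrite divr_gt0//; lra.
suff [om omr wv] : exists2 om, (1 - zeta) / beta < om <= 2 &
    Num.max 0 ((1 - eps) * sup E) < val om.
  exists om, (Num.max 0 ((1 - eps) * sup E)); split => //; first by rewrite le_max lexx.
  by rewrite le_max lexx orbT.
have [s0|s0] := lerP (sup E) 0.
  exists 2; first by rewrite lexx andbT ltr_pdivrMr//; lra.
  by rewrite gt_max val2/=; apply: le_lt_trans val2; rewrite mulr_ge0_le0// subr_ge0 ltW.
have /(@sup_gt _ E) : (1 - eps) * sup E < sup E by rewrite gtr_pMl// gtrBl.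
move=> /(_ (ex_intro _ _ E2))[_ [om /= omr <-] h].
rewrite in_itv/= in omr.
exists om; first exact: omr.
rewrite gt_max h andbT; apply: lt_trans h.
by rewrite mulr_gt0 ?subr_gt0.
Qed.

(** With [lam = g_fun r om * mu0] the moment of order [om = 1 + s] has exponent
[D = om * (2 * g_fun r om - 1 - r)] per unit of [mu0 * H]. The number [w] bounds
[mu0 * h / ln N] and falls short of the quotient defining [rho_fun], which
leaves the gap [gamma]. *)
Lemma rho_exponent (R : realType) (r mu0 beta zeta eps : R) :
  1 < r -> 0 < mu0 -> zeta < 1 -> (1 - zeta) / 2 < beta < 1 - zeta ->
  0 < eps < 1 ->
  exists s lam w D gamma : R,
    let a := mu0 / lam in let b := r * mu0 / lam in
   [/\ 0 < s <= 1, mu0 <= lam, [/\ 0 <= w, 0 <= D & 0 < gamma],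
    (1 - eps) * rho_fun r beta zeta <= w /\
    w * D = (1 + s) * beta - (1 - zeta) - gamma &
    lam * (a `^ (1 + s) + b `^ (1 + s) - 2 - (1 + s) * (a + b - 2)) = mu0 * D].
Proof.
move=> r1 mu00 z1 /andP[b1 b2] /andP[e0 e1].
have beta0 : 0 < beta by lra.
have r0 : 0 < r := lt_trans ltr01 r1.
have beta1 : 1 - zeta < 2 * beta by lra.
have [om [w [omr w0 rhow wv]]] :=
  rho_fun_witness r1 beta0 beta1 (introT andP (conj e0 e1)).
have /andP[om1 om2] := omr.
have om_gt1 : 1 < om by apply: le_lt_trans om1; rewrite ler_pdivlMr// mul1r ltW.
have om0 : 0 < om := lt_trans ltr01 om_gt1.
set val := (beta - _) / _ in wv.
have num0 : 0 < beta - om^-1 * (1 - zeta).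
  by rewrite subr_gt0 mulrC ltr_pdivrMr// mulrC -ltr_pdivrMr.
have den0 : 0 < 2 * g_fun r om - 1 - r.
  have : 0 < val := le_lt_trans w0 wv.
  by rewrite /val pmulr_rgt0// invr_gt0.
have gq : g_fun r om `^ om = (1 + r `^ om) / 2.
  rewrite /g_fun -powRrM mulVf ?gt_eqF// powRr1//.
  by rewrite divr_ge0// addr_ge0// powR_ge0.
set g := g_fun r om in den0 gq *.
have g0 : 0 < g by clear -den0 r0; lra.
(* [gamma] is the gap between [w] and the quotient, in units of [D]. *)
exists (om - 1), (g * mu0), w, (om * (2 * g - 1 - r)),
  ((val - w) * (om * (2 * g - 1 - r))).
rewrite /= (_ : 1 + (om - 1) = om); last by ring.
have aE : mu0 / (g * mu0) = g^-1 by field; rewrite !gt_eqF.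
have bE : r * mu0 / (g * mu0) = r / g by field; rewrite !gt_eqF.
split.
- lra.
- by rewrite ler_peMl ?(ltW mu00)//; lra.
- by split => //; rewrite ?mulr_gt0// ?subr_gt0// ltW// mulr_gt0.
- split => //.
  have -> : w * (om * (2 * g - 1 - r)) = val * (om * (2 * g - 1 - r)) -
     (val - w) * (om * (2 * g - 1 - r)) by ring.
  congr (_ - _); rewrite /val -/g; field; rewrite !gt_eqF//.
rewrite aE bE.
have gi : g^-1 `^ om + (r / g) `^ om = 2.
  rewrite powRM ?invr_ge0 ?(ltW r0) ?(ltW g0)//.
  rewrite -[X in X + _]mul1r -mulrDl.
  have -> : 1 + r `^ om = 2 * g `^ om by rewrite gq; field.
  rewrite -mulrA -powRM ?invr_ge0 ?(ltW g0)// mulfV ?gt_eqF// powR1 mulr1//.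
rewrite gi; field; rewrite gt_eqF//.
Qed.

Lemma prod_first (R : realType) (N V : nat) (x : R) : (V <= N)%N ->
  \prod_(n < N) (if (n < V)%N then x else 1) = x ^+ V.
Proof.
move=> VN; rewrite -big_mkcond -(big_ord_widen _ (fun=> x) VN).
by rewrite prodr_const card_ord.
Qed.

(** * The two regimes as the number of sequences grows *)

Lemma near_ln_ge (R : realType) (T : nat -> nat) (A : R) : T @ \oo --> \oo ->
  \forall N \near \oo, A <= ln (T N)%:R.
Proof.
move=> /cvgnyPge /(_ (Num.truncn (expR A)).+1); apply: filterS => N TN.
rewrite -(expRK A) ler_ln ?posrE ?expR_gt0//.
  by apply: (le_trans (ltW (truncnS_gt _))); rewrite ler_nat.
by rewrite ltr0n; exact: leq_ltn_trans TN.
Qed.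

Lemma asymp_equiv_bounds (R : realType) (a b : nat -> R) :
  asymp_equiv a b ->
  \forall N \near \oo, 0 < b N -> b N / 2 <= a N <= 2 * b N.
Proof.
move=> ab; near=> N => b0.
have h1 : 2^-1 < a N / b N.
  by near: N; apply: (cvgr_gt _ ab); rewrite invf_lt1 ?ltr1n.
have h2 : a N / b N < 2 by near: N; apply: (cvgr_lt _ ab); rewrite ltr1n.
move: h1 h2; rewrite ltr_pdivlMr// ltr_pdivrMr// => h1 h2.
by rewrite (ltW h2) andbT mulrC ltW.
Unshelve. all: by end_near. Qed.

Lemma not_cvg0_of_near_ge (R : realType) (u : nat -> R) (c : R) :
  0 < c -> (\forall N \near \oo, c <= u N) -> ~ u @ \oo --> (0 : R).
Proof.
move=> c0 u_ge u0; have u_lt : \forall N \near \oo, u N < c by exact: cvgr_lt u0 _ c0.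
have [N [/le_lt_trans h /h]] := filter_ex (filterI u_ge u_lt).
by rewrite ltxx.
Qed.

(** A deterministic set of [V] rows is the random set with inclusion
probabilities 1 and 0. The inequality [1 + y <= expR 1 * y] for [1 <= y] costs a factor
[expR V] in all, harmless when [V] is negligible against [ln T]. *)
Lemma fixed_set_prior (R : realType) (N V H : nat) (lam kap c s : R) :
  (V <= N)%N -> lam * kap <= c -> 0 <= c -> 0 < s ->
  let p := fun n : 'I_N => if (n < V)%N then 1 else 0 : R in
  [/\ forall n, 0 <= p n <= 1, 16 ^+ V * \prod_n (1 - 15 / 16 * p n) <= 1 &
    \prod_n (1 + p n `^ (1 + s) * expR (lam * H%:R * kap)) <=
    expR (V%:R * (1 + H%:R * c))].
Proof.
move=> VN kc c0 s0 p; split.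
- by move=> n; rewrite /p; case: ifP; rewrite ?lexx ?ler01.
- rewrite (eq_bigr (fun n : 'I_N => if (n < V)%N then 16^-1 else 1)) => [|n _].
    by rewrite prod_first// -exprMn mulfV// expr1n.
  by rewrite /p; case: ifP => _; lra.
rewrite (eq_bigr (fun n : 'I_N =>
    if (n < V)%N then 1 + expR (lam * H%:R * kap) else 1)); last first.
  move=> n _; rewrite /p; case: ifP => _; first by rewrite powR1 mul1r.
  by rewrite powR0 ?mul0r ?addr0//; lra.
rewrite prod_first// expRM_natl lerXn2r ?nnegrE ?expR_ge0 ?addr_ge0 ?expR_ge0//.
have e1 : 2 <= expR 1 :> R by have := expR_ge1Dx (1 : R); lra.
have Hc0 : 0 <= H%:R * c by rewrite mulr_ge0.
have e2 : expR (lam * H%:R * kap) <= expR (H%:R * c).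
  by rewrite ler_expR mulrAC (mulrC _ H%:R) ler_wpM2l.
have e3 : 1 <= expR (H%:R * c) by have := expR_ge1Dx (H%:R * c); lra.
rewrite expRD; apply: (le_trans _ (ler_wpM2r (expR_ge0 _) e1)); lra.
Qed.

(** The expected number [8 * V] of changing rows exceeds [V] by a factor large
enough for Chernoff's bound, as [16 <= expR (15 / 2)]. *)
Lemma bernoulli_prior (R : realType) (N V : nat) (K s : R) :
  (0 < N)%N -> 8 * V%:R <= N%:R :> R -> 0 <= K ->
  let p := fun _ : 'I_N => 8 * V%:R / N%:R : R in
  [/\ forall n, 0 <= p n <= 1, 16 ^+ V * \prod_n (1 - 15 / 16 * p n) <= 1 &
    \prod_n (1 + p n `^ (1 + s) * K) <=
    expR (N%:R * ((8 * V%:R / N%:R) `^ (1 + s) * K))].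
Proof.
move=> N0 VN K0 p.
have NR : 0 < N%:R :> R by rewrite ltr0n.
have p01 n : 0 <= p n <= 1.
  by rewrite /p divr_ge0 ?mulr_ge0//= ler_pdivrMr// mul1r.
split => //.
- have e1 : 16 <= expR (15 / 2) :> R.
    apply: (@le_trans _ _ (expR (4%:R * 1))); last by rewrite ler_expR; lra.
    rewrite expRM_natl; have := expR_ge1Dx (1 : R) => h.
    apply: (@le_trans _ _ (2 ^+ 4)); first by rewrite -natrX ler_nat.
    by rewrite lerXn2r ?nnegrE ?expR_ge0//; lra.
  apply: (@le_trans _ _ (16 ^+ V * expR (- (15 / 2)) ^+ V)); last first.
    rewrite -exprMn exprn_ile1 ?mulr_ge0 ?expR_ge0//.
    by rewrite expRN ler_pdivrMr ?expR_gt0// mul1r.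
  rewrite ler_wpM2l ?exprn_ge0// -expRM_natl.
  have -> : V%:R * - (15 / 2) = N%:R * (- (15 / 16 * (8 * V%:R / N%:R))) :> R.
    by field; rewrite gt_eqF.
  rewrite expRM_natl -[X in _ <= _ ^+ X]card_ord -prodr_const.
  apply: ler_prod => n _; apply/andP; split.
    by have /andP[_ p1] := p01 n; lra.
  exact: expR_ge1Dx.
- rewrite expRM_natl -[X in _ <= _ ^+ X]card_ord -prodr_const.
  apply: ler_prod => n _; apply/andP; split; last exact: expR_ge1Dx.
  by rewrite addr_ge0// mulr_ge0// powR_ge0.
Qed.

Section asymptotics.
Context (R : realType) (T V : nat -> nat) (h : nat -> R)
    (zeta Delta r eps mu0 : R)
    (d : nat -> measure_display) (Omega : forall N, measurableType (d N))
    (P : forall N, 'M[R]_(N, T N) -> probability (Omega N) R)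
    (X : forall N, Omega N -> 'M[nat]_(N, T N))
    (zeta_gt0 : 0 < zeta) (zeta_lt1 : zeta < 1)
    (T_infty : T @ \oo --> \oo)
    (T_asymp : asymp_equiv (fun N => ln (T N)%:R) (fun N => N%:R `^ zeta))
    (Delta_gt0 : 0 < Delta) (r_def : r = expR Delta)
    (eps_gt0 : 0 < eps) (eps_lt1 : eps < 1) (mu0_gt0 : 0 < mu0)
    (V_gt0 : forall N, (0 < V N)%N)
    (model : forall N, poisson_model (@P N) (@X N))
    (test : forall N, 'M[nat]_(N, T N) -> bool).

Let err N := sup_type1_error (@P N) (@X N) (Lambda0 mu0) (@test N) +
  sup_type2_error (@P N) (@X N) (Lambda1 mu0 Delta (V N) (h N)) (@test N).

Let r_gt1 : 1 < r.
Proof. by rewrite r_def expR_gt1. Qed.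

Let powN N (y : R) : (0 < N)%N -> N%:R `^ y = expR (y * ln N%:R).
Proof. by move=> N0; rewrite /powR pnatr_eq0 -leqn0 leqNgt N0. Qed.

(** The gap [sigma] is half of [1 - (1 - eps) * (1 + eps)]: one factor comes from
[h], the other from [midpoint_exponent], and the other half absorbs the terms
of order [V]. *)
Lemma risk_sparse_changes :
  (fun N => (V N)%:R : R) =o_\oo (fun N => ln (T N)%:R / ln N%:R : R) ->
  (forall N, h N = (1 - eps) * (I_rate r)^-1 * (ln (T N)%:R / (mu0 * (V N)%:R))) ->
  \forall N \near \oo, 5 / 16 <= err N.
Proof.
move=> Vo hE.
have I0 := I_rate_gt0 r_gt1.
have [s [s01 kap_le]] := midpoint_exponent r_gt1 mu0_gt0 eps_gt0.
have /andP[s0 s1] := s01.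
set lam := (r + 1) / 2 * mu0 in kap_le.
pose C := (I_rate r * mu0)^-1 + 1; pose sigma := eps ^+ 2 / 2.
pose c := mu0 * (s * I_rate r * (1 + eps)).
have c0 : 0 < c by rewrite !mulr_gt0// addr_gt0.
pose delta := Num.min 2^-1 (sigma * s / (1 + c)).
have sg0 : 0 < sigma by rewrite divr_gt0// exprn_gt0.
have sg1 : sigma < 1.
  have : eps ^+ 2 <= 1 by rewrite exprn_ile1// ltW.
  by rewrite /sigma; lra.
have dl0 : 0 < delta.
  by rewrite lt_min invr_gt0 ltr0n/= divr_gt0 ?mulr_gt0 ?addr_gt0.
have C0 : 0 < C by rewrite addr_gt0// invr_gt0 mulr_gt0.
have lamr : mu0 <= lam.
  by rewrite /lam ler_peMl ?(ltW mu0_gt0)//; have := r_gt1; lra.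
pose l N : R := ln (T N)%:R.
have sg2 : 0 < sigma / 2 by rewrite divr_gt0.
near=> N.
have l1 : 1 <= l N by near: N; exact: near_ln_ge.
have l0 : 0 <= l N := le_trans ler01 l1.
have l2 : 2 * ln (64 * C / sigma) <= l N by near: N; exact: near_ln_ge.
have l3 : ln (64 * C / sigma) + ln 8 / s <= sigma / 2 * l N.
  rewrite -(ler_pdivrMl _ _ sg2); near: N; exact: near_ln_ge.
have N0 : (0 < N)%N by near: N; exact: nbhs_infty_gt.
have nu1 : 1 <= ln N%:R :> R by near: N; apply: (@near_ln_ge _ id).
have Vd : (V N)%:R <= delta * l N.
  have : `|(V N)%:R| <= delta * `|l N / ln N%:R|.
    by near: N; move/eqoP : Vo => /(_ _ dl0).
  rewrite normr_nat ger0_norm; last by rewrite divr_ge0// (le_trans _ nu1).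
  move=> /le_trans; apply; rewrite ler_wpM2l ?(ltW dl0)//.
  by rewrite ler_pdivrMr ?ler_peMr// (lt_le_trans _ nu1).
have VN : (V N <= N)%N.
  have Np : N%:R `^ zeta <= N%:R :> R.
    rewrite -[leRHS](@powRr1 _ N%:R)// ler_powR ?ler1n// ltW//.
  have Np0 : 0 < N%:R `^ zeta :> R by apply: powR_gt0; rewrite ltr0n.
  have : 0 < N%:R `^ zeta -> N%:R `^ zeta / 2 <= l N <= 2 * N%:R `^ zeta.
    by near: N; exact: asymp_equiv_bounds T_asymp.
  move=> /(_ Np0) /andP[_ lN]; rewrite -(ler_nat R).
  have : delta * l N <= 2^-1 * l N by rewrite ler_wpM2r ?ge_min ?lexx//; lra.
  lra.
have VR1 : 1 <= (V N)%:R :> R by rewrite ler1n.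
have h0 : 0 <= h N.
  rewrite hE -/(l N); apply: mulr_ge0.
    by rewrite mulr_ge0 ?invr_ge0 ?subr_ge0 ?(ltW eps_lt1) ?(ltW I0).
  by rewrite divr_ge0// mulr_ge0// ltW.
have [H [H0 hH Hle]] := truncn_window (h N).
rewrite max_l// in Hle.
have [p01 tail Bl] := @fixed_set_prior R N (V N) H lam _ c s VN kap_le (ltW c0) s0.
have Vh : (V N)%:R * mu0 * h N * I_rate r = (1 - eps) * l N.
  rewrite hE -/(l N); field; rewrite !gt_eqF//=; exact: lt_le_trans VR1.
have HC : H%:R <= C * l N.
  have : h N <= (I_rate r * mu0)^-1 * l N.
    rewrite -(@ler_pM2l _ ((V N)%:R * mu0 * I_rate r)) ?mulr_gt0 ?ltr0n//.
    have -> : (V N)%:R * mu0 * I_rate r * h N = (1 - eps) * l N by rewrite -Vh; ring.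
    have -> : (V N)%:R * mu0 * I_rate r * ((I_rate r * mu0)^-1 * l N) = (V N)%:R * l N.
      by field; rewrite !gt_eqF.
    by rewrite ler_wpM2r// (le_trans _ VR1)// gerBl ltW.
  by move=> hC; rewrite /C mulrDl mul1r (le_trans Hle)// lerD.
have sg01 : 0 < sigma < 1 by rewrite sg0.
rewrite /err; apply: (risk_ge_of_log_bounds (@test N) (model N) mu0_gt0 lamr Delta_gt0 s01 H0 hH
  (V_gt0 N) p01 tail C0 sg01 HC _ l2 l3).
rewrite -r_def; apply: (le_trans Bl); rewrite ler_expR.
apply: (@le_trans _ _ ((V N)%:R * (1 + (h N + 1) * c))).
  by rewrite ler_wpM2l// lerD2l ler_wpM2r// ltW.
have -> : (V N)%:R * (1 + (h N + 1) * c) =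
    (V N)%:R * (1 + c) + s * (1 + eps) * ((V N)%:R * mu0 * h N * I_rate r).
  by rewrite /c; ring.
have -> : (1 - sigma) * s * ln (T N)%:R =
    sigma * s * l N + s * (1 + eps) * ((1 - eps) * l N).
  by rewrite /sigma /l; field.
rewrite Vh; have : (V N)%:R * (1 + c) <= sigma * s * l N.
  have c1 : 0 < 1 + c by rewrite addr_gt0.
  apply: (@le_trans _ _ (delta * l N * (1 + c))); first by rewrite ler_wpM2r// ltW.
  rewrite mulrAC ler_wpM2r//.
  by rewrite -ler_pdivlMr ?addr_gt0// ge_min lexx orbT.
by rewrite lerD2r.
Unshelve. all: by end_near. Qed.

(** With [nu = ln N], the exponents of [N], of [p ^ (1 + s)] and of the row moment
add up to [(zeta - gamma) * nu + C3], while [ln T] is at least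
[expR (zeta * nu) / 2]. *)
Lemma risk_dense_changes (beta : R) :
  (1 - zeta) / 2 < beta < 1 - zeta ->
  asymp_equiv (fun N => (V N)%:R) (fun N => N%:R `^ (1 - beta)) ->
  (forall N, h N = (1 - eps) * rho_fun r beta zeta * (ln N%:R / mu0)) ->
  \forall N \near \oo, 5 / 16 <= err N.
Proof.
move=> betar V_asymp hE.
have [s [lam [w [D [gamma]]]]] := rho_exponent r_gt1 mu0_gt0 zeta_lt1 betar
  (introT andP (conj eps_gt0 eps_lt1)).
move=> /= [s01 lamr [w0 D0 g0] [rhow wD] kapE].
have /andP[s0 s1] := s01.
have beta0 : 0 < beta by have /andP[b1 _] := betar; lra.
pose C := 2 * w / (mu0 * zeta) + 1; pose sigma : R := 2^-1.
pose C3 := (1 + s) * ln 16 + mu0 * D.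
have sg01 : 0 < sigma < 1 by rewrite /sigma; lra.
have C0 : 0 < C by rewrite ltr_wpDl// divr_ge0 ?mulr_ge0// ltW.
have sg2 : 0 < sigma / 2 by rewrite divr_gt0//; have /andP[] := sg01.
have q0 : 0 <= 1 + s by rewrite addr_ge0// ltW.
pose l N : R := ln (T N)%:R; pose nu N : R := ln N%:R.
near=> N.
have l1 : 1 <= l N by near: N; exact: near_ln_ge.
have l2 : 2 * ln (64 * C / sigma) <= l N by near: N; exact: near_ln_ge.
have l3 : ln (64 * C / sigma) + ln 8 / s <= sigma / 2 * l N.
  rewrite -(ler_pdivrMl _ _ sg2); near: N; exact: near_ln_ge.
have N0 : (0 < N)%N by near: N; exact: nbhs_infty_gt.
have nu1 : 1 <= nu N by near: N; apply: (@near_ln_ge _ id).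
have nuA : C3 - ln (s / 4) <= gamma * nu N.
  by rewrite -(ler_pdivrMl _ _ g0); near: N; apply: (@near_ln_ge _ id).
have nuB : ln 16 <= beta * nu N.
  by rewrite -(ler_pdivrMl _ _ beta0); near: N; apply: (@near_ln_ge _ id).
have nu0 : 0 <= nu N := le_trans ler01 nu1.
have NR : N%:R = expR (nu N) :> R by rewrite lnK// posrE ltr0n.
have l_lb : expR (zeta * nu N) / 2 <= l N.
  have : 0 < N%:R `^ zeta -> N%:R `^ zeta / 2 <= l N <= 2 * N%:R `^ zeta.
    by near: N; exact: asymp_equiv_bounds T_asymp.
  by rewrite powN// expR_gt0 => /(_ isT) /andP[].
have V_ub : (V N)%:R <= 2 * expR ((1 - beta) * nu N).
  have : 0 < N%:R `^ (1 - beta) ->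
      N%:R `^ (1 - beta) / 2 <= ((V N)%:R : R) <= 2 * N%:R `^ (1 - beta).
    by near: N; exact: asymp_equiv_bounds V_asymp.
  by rewrite powN// expR_gt0 => /(_ isT) /andP[].
have p_le : 8 * (V N)%:R / N%:R <= expR (ln 16 - beta * nu N).
  rewrite ler_pdivrMr ?ltr0n// NR -expRD.
  have -> : ln 16 - beta * nu N + nu N = ln 16 + (1 - beta) * nu N by ring.
  by rewrite expRD lnK ?posrE//; move: V_ub; lra.
have VN : 8 * (V N)%:R <= N%:R :> R.
  rewrite -[leRHS]mul1r -ler_pdivrMr ?ltr0n//; apply: (le_trans p_le).
  by rewrite expR_le1 subr_le0.
have [H [H0 hH Hle]] := truncn_window (h N).
have hw : mu0 * Num.max (h N) 0 <= w * nu N.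
  rewrite maxr_pMr ?(ltW mu0_gt0)// mulr0 ge_max mulr_ge0// andbT hE -/(nu N).
  rewrite mulrCA (mulrCA mu0) mulfV ?gt_eqF// mulr1.
  by rewrite ler_wpM2r.
have HC : H%:R <= C * l N.
  apply: (le_trans Hle); rewrite /C mulrDl mul1r; apply: lerD => //.
  have nul : zeta * nu N <= 2 * l N.
    have := expR_ge1Dx (zeta * nu N); move: l_lb; lra.
  have -> : 2 * w / (mu0 * zeta) * l N = mu0^-1 * (w * (zeta^-1 * (2 * l N))).
    by field; rewrite !gt_eqF.
  rewrite ler_pdivlMl//; apply: (le_trans hw).
  by rewrite ler_wpM2l// ler_pdivlMl.
set a := mu0 / lam in kapE; set b := r * mu0 / lam in kapE.
set kap := (_ - _ - _) in kapE.
have [p01 tail Bl] := @bernoulli_prior R N (V N) (expR (lam * H%:R * kap)) s N0 VN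
  (expR_ge0 _).
rewrite /err; apply: (risk_ge_of_log_bounds (@test N) (model N) mu0_gt0 lamr Delta_gt0
  s01 H0 hH (V_gt0 N) p01 tail C0 sg01 HC _ l2 l3).
rewrite -r_def -/a -/b -/kap; apply: (le_trans Bl); rewrite ler_expR -/(l N).
have pq_le : (8 * (V N)%:R / N%:R) `^ (1 + s) <= expR ((ln 16 - beta * nu N) * (1 + s)).
  by rewrite expRM ge0_ler_powR ?nnegrE ?expR_ge0// divr_ge0// mulr_ge0.
have K_le : expR (lam * H%:R * kap) <= expR (w * nu N * D + mu0 * D).
  rewrite ler_expR mulrAC kapE mulrAC -mulrDl ler_wpM2r//.
  apply: (le_trans (ler_wpM2l (ltW mu0_gt0) Hle)).
  by rewrite mulrDr mulr1 lerD2r.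
apply: (@le_trans _ _ (expR (nu N) *
    (expR ((ln 16 - beta * nu N) * (1 + s)) * expR (w * nu N * D + mu0 * D)))).
  by rewrite NR ler_wpM2l ?expR_ge0// ler_pM ?powR_ge0 ?expR_ge0// -NR.
rewrite -!expRD.
have -> : nu N + ((ln 16 - beta * nu N) * (1 + s) + (w * nu N * D + mu0 * D)) =
    zeta * nu N + (C3 - gamma * nu N).
  by rewrite (mulrAC w) wD /C3; ring.
rewrite expRD.
apply: (@le_trans _ _ (expR (zeta * nu N) * (s / 4))).
  rewrite ler_wpM2l ?expR_ge0// -[leRHS]lnK ?posrE ?divr_gt0// ler_expR.
  by rewrite lerBlDl -lerBlDr.
have -> : (1 - sigma) * s * l N = 2^-1 * (s * l N) by rewrite /sigma; field.
have -> : expR (zeta * nu N) * (s / 4) = 2^-1 * (s * (expR (zeta * nu N) / 2)) by field.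
by rewrite !ler_wpM2l// ltW.
Unshelve. all: by end_near. Qed.

End asymptotics.

Theorem theorem4 (R : realType) (T V : nat -> nat) (h : nat -> R)
    (zeta Delta r eps mu0 : R)
    (d : nat -> measure_display) (Omega : forall N, measurableType (d N))
    (P : forall N, 'M[R]_(N, T N) -> probability (Omega N) R)
    (X : forall N, Omega N -> 'M[nat]_(N, T N))
    (zeta_gt0 : 0 < zeta) (zeta_lt1 : zeta < 1)
    (T_infty : T @ \oo --> \oo)
    (T_asymp : asymp_equiv (fun N => ln (T N)%:R) (fun N => N%:R `^ zeta))
    (Delta_gt0 : 0 < Delta) (r_def : r = expR Delta)
    (eps_gt0 : 0 < eps) (eps_lt1 : eps < 1) (mu0_gt0 : 0 < mu0)
    (V_gt0 : forall N, (0 < V N)%N)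
    (model : forall N, poisson_model (P N) (X N))
    (condition :
      ((fun N => (V N)%:R : R) =o_\oo (fun N => ln (T N)%:R / ln N%:R : R) /\
       forall N, h N =
         (1 - eps) * (I_rate r)^-1 * (ln (T N)%:R / (mu0 * (V N)%:R)))
      \/
      (exists beta : R,
        [/\ (1 - zeta) / 2 < beta < 1 - zeta,
            asymp_equiv (fun N => (V N)%:R) (fun N => N%:R `^ (1 - beta)) &
            forall N, h N =
              (1 - eps) * rho_fun r beta zeta * (ln N%:R / mu0)])) :
  ~ exists test : forall N, 'M[nat]_(N, T N) -> bool,
      (fun N =>
         sup_type1_error (P N) (X N) (Lambda0 mu0) (test N) +
         sup_type2_error (P N) (X N) (Lambda1 mu0 Delta (V N) (h N)) (test N))
      @ \oo --> (0 : R).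
Proof.
move=> [test]; apply: not_cvg0_of_near_ge (_ : 0 < 5 / 16) _; first by lra.
case: condition => [[Vo hE]|[beta [betar V_asymp hE]]].
  exact: (risk_sparse_changes zeta_lt1 T_infty T_asymp Delta_gt0 r_def eps_gt0
    eps_lt1 mu0_gt0 V_gt0 model test Vo hE).
exact: (risk_dense_changes zeta_gt0 zeta_lt1 T_infty T_asymp Delta_gt0 r_def
  eps_gt0 eps_lt1 mu0_gt0 V_gt0 model test betar V_asymp hE).
Qed.
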